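(* There is a one to one correspondence between the set $\mathcal{R}_0/{\sim}$ of equivalence classes of involutive R-matrices and the set of ordered pairs of Young diagrams different from the pair $(\emptyset,\emptyset)$, under which, for each $d\in\mathbb{N}$, the classes of R-matrices of dimension $d$ correspond exactly to the pairs of Young diagrams with $d$ boxes in total.
   Context: $\mathbb{N}=\{1,2,\dots\}$. Let $V$ be a nonzero finite-dimensional complex Hilbert space. An involutive R-matrix with base space $V$ and dimension $d=\dim V$ is a unitary $R\in\mathrm{End}(V\otimes V)$ with $R^2=1$ satisfying the Yang-Baxter equation $(R\otimes \mathrm{id}_V)(\mathrm{id}_V\otimes R)(R\otimes \mathrm{id}_V)=(\mathrm{id}_V\otimes R)(R\otimes \mathrm{id}_V)(\mathrm{id}_V\otimes R)$. The set of these is $\mathcal{R}_0(V)$, and $\mathcal{R}_0$ is the union of $\mathcal{R}_0(V)$ over all such $V$. For $n\in\mathbb{N}$, $R\in\mathcal{R}_0(V)$ defines a unitary representation $\rho_R^{(n)}$ of the symmetric group $S_n$ on $V^{\otimes n}$ by sending the transposition $(k,k+1)$ to $\mathrm{id}_V^{\otimes(k-1)}\otimes R\otimes\mathrm{id}_V^{\otimes(n-k-1)}$, $1\le k\le n-1$ (for $n=1$, $\rho_R^{(1)}=\mathrm{id}_V$ on $V$). Two involutive R-matrices $R,S$ (possibly with different base spaces) are equivalent, $R\sim S$, iff for every $n\in\mathbb{N}$ the representations $\rho_R^{(n)}$ and $\rho_S^{(n)}$ of $S_n$ are equivalent. Equivalent R-matrices have the same dimension. A Young diagram is the diagram of an integer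 partition (possibly empty), its number of boxes being the integer that is partitioned. *)

(* Defs.v *)
From HB Require Import structures.
From mathcomp Require Import all_boot all_order all_algebra all_fingroup.
From mathcomp Require Import sesquilinear.

Set Implicit Arguments.
Unset Strict Implicit.
Unset Printing Implicit Defensive.

Import Order.TTheory GRing.Theory Num.Theory.
Local Open Scope ring_scope.

Section Tensor.
Variable K : fieldType.
Implicit Types U V W : vectType K.

(* In finite dimension V (x) W is the space of linear maps from the dual of V
   to W, the pure tensor v (x) w being phi |-> phi(v) w. *)
Definition tensor V W : vectType K := 'Hom('Hom(V, K^o), W).

Definition pure V W (v : V) (w : W) : tensor V W :=
  linfun (fun phi : 'Hom(V, K^o) => (phi v : K) *: w).

Definition tensor_map V V' W W' (f : 'Hom(V, V')) (g : 'Hom(W, W')) :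
    'Hom(tensor V W, tensor V' W') :=
  linfun (fun T : tensor V W =>
    linfun (fun phi : 'Hom(V', K^o) => g (T (phi \o f)%VF)) : tensor V' W').

(* The associator, (u (x) v) (x) w |-> u (x) (v (x) w). *)
Definition tensor_assoc U V W :
    'Hom(tensor (tensor U V) W, tensor U (tensor V W)) :=
  linfun (fun X : tensor (tensor U V) W =>
    linfun (fun phi : 'Hom(U, K^o) =>
      linfun (fun psi : 'Hom(V, K^o) =>
        X (linfun (fun T : tensor U V => psi (T phi)))) : tensor V W)
    : tensor U (tensor V W)).

(* V^{(x) n}, nested to the right and ending with the ground field. *)
Fixpoint tensor_pow V (n : nat) : vectType K :=
  if n is m.+1 then tensor V (tensor_pow V m) else K^o.

(* id^{(x) k} (x) A (x) id^{(x) (n - k - 2)} on V^{(x) n}, with k counted from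
   0; the identity when k.+1 >= n. *)
Fixpoint op_at V (A : 'End(tensor V V)) (n k : nat) {struct n} :
    'End(tensor_pow V n) :=
  match n, k return 'End(tensor_pow V n) with
  | 0, _ => \1%VF
  | m.+1, k'.+1 => tensor_map \1%VF (op_at A m k')
  | m.+1, 0 =>
      match m return 'End(tensor V (tensor_pow V m)) with
      | 0 => \1%VF
      | p.+1 => let a := tensor_assoc V V (tensor_pow V p) in
                (a \o tensor_map A \1 \o a^-1)%VF
      end
  end.

(* Both sides are endomorphisms of (V (x) V) (x) V. *)
Definition yang_baxter V (A : 'End(tensor V V)) : Prop :=
  let a := tensor_assoc V V V in
  let A12 := tensor_map A \1%VF in
  let A23 := (a^-1 \o tensor_map \1 A \o a)%VF in
  (A12 \o A23 \o A12 = A23 \o A12 \o A23)%VF.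


Lemma linfunK V W (f : V -> W) : linear f -> linfun f =1 f.
Proof.
move=> lin_f; pose F := GRing.isLinear.Build _ _ _ _ f lin_f.
by pose f' : {linear _ -> _} := HB.pack f F; exact: (lfunE f').
Qed.

Lemma lfun_combE V W c (f g : 'Hom(V, W)) x : (c *: f + g) x = c *: f x + g x.
Proof. by rewrite add_lfunE scale_lfunE. Qed.

Lemma pureE V W (v : V) (w : W) phi : pure v w phi = (phi v : K) *: w.
Proof.
by rewrite linfunK // => c p q; rewrite lfun_combE scalerDl scalerA.
Qed.

Lemma tensor_mapE V V' W W' (f : 'Hom(V, V')) (g : 'Hom(W, W'))
    (T : tensor V W) phi :
  tensor_map f g T phi = g (T (phi \o f)%VF).
Proof.
have E T' : linfun (fun phi : 'Hom(V', K^o) => g ((T' : tensor V W) (phi \o f)%VF))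
    =1 fun phi => g (T' (phi \o f)%VF).
  apply: linfunK => c p q; rewrite -!linearP; congr (g (T' _)).
  by apply/lfunP=> u; rewrite lfun_combE !comp_lfunE lfun_combE.
rewrite linfunK ?E // => c p q; apply/lfunP=> u.
by rewrite lfun_combE !E lfun_combE linearP.
Qed.

Lemma tensor_map_pure V V' W W' (f : 'Hom(V, V')) (g : 'Hom(W, W')) v w :
  tensor_map f g (pure v w) = pure (f v) (g w).
Proof.
by apply/lfunP=> phi; rewrite tensor_mapE !pureE comp_lfunE linearZ.
Qed.

Lemma tensor_assocE U V W (X : tensor (tensor U V) W) phi psi :
  tensor_assoc U V W X phi psi =
  X (linfun (fun T : tensor U V => psi (T phi))).
Proof.
have E1 (p : 'Hom(U, K^o)) (s : 'Hom(V, K^o)) :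
    linfun (fun T : tensor U V => s (T p)) =1 fun T => s (T p).
  by apply: linfunK => c x y; rewrite lfun_combE linearP.
have E2 (Y : tensor (tensor U V) W) (p : 'Hom(U, K^o)) :
    linfun (fun s : 'Hom(V, K^o) => Y (linfun (fun T : tensor U V => s (T p))))
    =1 fun s => Y (linfun (fun T : tensor U V => s (T p))).
  apply: linfunK => c x y; rewrite -linearP; congr (Y _).
  by apply/lfunP=> T; rewrite lfun_combE !E1 lfun_combE.
have E3 (Y : tensor (tensor U V) W) :
    linfun (fun p : 'Hom(U, K^o) => linfun (fun s : 'Hom(V, K^o) =>
      Y (linfun (fun T : tensor U V => s (T p)))) : tensor V W)
    =1 fun p => linfun (fun s : 'Hom(V, K^o) =>
      Y (linfun (fun T : tensor U V => s (T p)))).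
  apply: linfunK => c x y; apply/lfunP=> s.
  rewrite lfun_combE !E2 -linearP; congr (Y _).
  by apply/lfunP=> T; rewrite lfun_combE !E1 !linearP.
rewrite linfunK ?E3 ?E2 // => c x y; apply/lfunP=> p; apply/lfunP=> s.
by rewrite !lfun_combE !E3 !E2 lfun_combE.
Qed.

Lemma tensor_assoc_pure U V W (u : U) (v : V) (w : W) :
  tensor_assoc U V W (pure (pure u v) w) = pure u (pure v w).
Proof.
apply/lfunP=> phi; apply/lfunP=> psi.
rewrite tensor_assocE !pureE scale_lfunE pureE scalerA linfunK ?pureE ?linearZ //.
by move=> c x y; rewrite lfun_combE linearP.
Qed.

End Tensor.

Section RMatrix.
Variable K : numClosedFieldType.

(* A finite-dimensional Hilbert space; the inner product is linear in its
   first argument. *)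
Record hilbert := Hilbert {
  carrier :> vectType K;
  inner : {dot carrier for Num.Def.conjC}
}.

(* The inner product of V (x) V, characterised by tensor_inner_pure below. With
   b_i a basis of V, not necessarily orthonormal, and b_i^* the dual basis, an
   element T is the sum of the b_i (x) T(b_i^* ). *)
Definition tensor_inner (V : hilbert) (S T : tensor V V) : K :=
  let b := vbasis {:V} in
  let dual i : 'Hom(V, K^o) := linfun (coord b i : V -> K^o) in
  \sum_(i < \dim {:V}) \sum_(j < \dim {:V})
    inner V b`_i b`_j * inner V (S (dual i)) (T (dual j)).

Lemma tensor_inner_pure (V : hilbert) (v v' w w' : V) :
  tensor_inner (pure v w) (pure v' w') = inner V v v' * inner V w w'.
Proof.
have E u x i : pure u x (linfun (coord (vbasis {:V}) i : V -> K^o))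
    = coord (vbasis {:V}) i u *: x.
  by rewrite pureE linfunK //; exact: linearP.
rewrite [in RHS](coord_vbasis (memvf v)) [in RHS](coord_vbasis (memvf v')).
rewrite linear_sumlz mulr_suml; apply: eq_bigr => i _.
rewrite linear_sumr mulr_suml; apply: eq_bigr => j _.
by rewrite !E !linearZl_LR !linearZr_LR /= mulrCA -!mulrA; congr (_ * _); rewrite mulrCA.
Qed.

(* In finite dimension an isometric endomorphism is automatically surjective. *)
Definition unitary (V : hilbert) (A : 'End(tensor V V)) : Prop :=
  forall S T, tensor_inner (A S) (A T) = tensor_inner S T.

Record Rmatrix := RMatrix {
  base : hilbert;
  base_gt0 : (0 < \dim {:base})%N;
  Rop : 'End(tensor base base);
  Rop_unitary : unitary Rop;
  Rop_invol : (Rop \o Rop)%VF = \1%VF;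
  Rop_YB : yang_baxter Rop
}.

Definition Rdim (R : Rmatrix) : nat := \dim {:base R}.

(* rho is the representation of S_n on V^{(x) n} determined by R. In 'S_n the
   product t * s is the permutation "first t, then s". *)
Definition is_rho (R : Rmatrix) (n : nat)
    (rho : 'S_n -> 'End(tensor_pow (base R) n)) : Prop :=
  [/\ rho 1%g = \1%VF,
      forall s t : 'S_n, rho (t * s)%g = (rho s \o rho t)%VF
    & forall i j : 'I_n, j = i.+1 :> nat ->
        rho (tperm i j) = op_at (Rop R) n i].

Definition equiv_rep (n : nat) (X Y : vectType K)
    (rho : 'S_n -> 'End(X)) (sigma : 'S_n -> 'End(Y)) : Prop :=
  exists F : 'Hom(X, Y),
    bijective F /\ forall s : 'S_n, (F \o rho s = sigma s \o F)%VF.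

Definition Requiv (R S : Rmatrix) : Prop :=
  forall n : nat, (0 < n)%N ->
    exists rho sigma,
      [/\ @is_rho R n rho, @is_rho S n sigma & equiv_rep rho sigma].

(* The quotient of Rmatrix by Requiv: its elements are the equivalence classes,
   as subsets of Rmatrix. A dedicated record avoids the universe levels of
   mathcomp's set and of sig, which lie below the one of Rmatrix. *)
Record Rclass := RClass {
  Rclass_mem :> Rmatrix -> Prop;
  RclassP : exists R : Rmatrix, Rclass_mem = Requiv R
}.

Definition Rclass_has_dim (C : Rclass) (d : nat) : Prop :=
  exists2 R : Rmatrix, C R & Rdim R = d.

End RMatrix.

(* A Young diagram is given by its row lengths: a nonincreasing sequence of
   positive integers. *)
Definition young : Type := {s : seq nat | sorted geq s && (0%N \notin s)}.

Definition young0 : young := exist _ [::] isT.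

Definition boxes (y : young) : nat := sumn (val y).

Definition young_pair : Type :=
  {p : young * young | p != (young0, young0)}.

Definition pair_boxes (p : young_pair) : nat :=
  (boxes (val p).1 + boxes (val p).2)%N.

(* Main.v *)
Require Import Defs.
From mathcomp Require Import all_boot all_order all_algebra complex reals.
From HB Require Import structures.
From mathcomp Require Import all_fingroup sesquilinear spectral zify ring boolp.

(* Let T be the partial trace of R over its first tensor factor; T is
   self-adjoint. With T_i denoting T acting on site i, the Hilbert-Schmidt norm
   of R T_1 R - T_2 is computed from cyclicity of the trace, the Yang-Baxter
   equation and R^2 = 1, and turns out to be 0, so R T_1 = T_2 R. Hence, taking
   the trace of a permutation one site at a time, every character value of
   rho_R^(n) is a polynomial in the power sums tr T^k, and tr T^k is itself the
   value at a cycle: R ~ S iff T_R and T_S have the same spectrum.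

   Let c be an eigenvalue of T of multiplicity D, with eigenprojection P. The
   (anti)symmetrizer restricted to the range of P^{(x) n} has trace
   prod_{k < n} (D +- k c) / n!, which must therefore be a natural number for
   all n. This forces c = +-a with a a positive integer dividing D. An
   eigenvalue +-a of multiplicity a m contributes m rows of length a to the
   first, respectively second, diagram. Conversely, given two diagrams, cut a
   basis into blocks of the row lengths and let R be +-1 on (block) (x) (same
   block) and the flip on different blocks. *)
Set Implicit Arguments.
Unset Strict Implicit.
Unset Printing Implicit Defensive.

Import Order.TTheory GRing.Theory Num.Theory VectorInternalTheory.
Local Open Scope ring_scope.

(** * Linear maps, traces and tensor products *)


(** Unitarity acts through the self-adjointness of R, and does so twice: it makes T diagonalizable,
    and it lets a vanishing Hilbert-Schmidt norm force R T_1 R = T_2. Tracing out a site leaves one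
    more factor T on another site, so the induction on characters must allow an arbitrary function
    of T at every site. Indicator functions are among these, which is how the eigenprojections enter
    the symmetrizers. The trace of a symmetrizer is a natural number because it is the trace of an
    idempotent. The arithmetic then splits on whether some factor D + k e c with e = +-1 vanishes: a
    vanishing factor exhibits c as -+D / k and integrality gives k | D, while positivity of all
    factors for both signs would force c = 0. Equality of characters is converted into an
    equivalence by repeatedly raising the rank of an intertwiner, with no decomposition into
    irreducibles. *)

Section LfunTrace.
Variable K : fieldType.
Implicit Types U V W Z : vectType K.

Lemma comp_lfun_suml U V W I (r : seq I) (P : pred I)
    (f : I -> 'Hom(V, W)) (g : 'Hom(U, V)) :
  ((\sum_(i <- r | P i) f i) \o g = \sum_(i <- r | P i) (f i \o g))%VF.
Proof.
apply: (big_morph (fun h => h \o g)%VF) => [x y|]; first exact: comp_lfunDl.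
exact: comp_lfun0l.
Qed.

Lemma comp_lfun_sumr U V W I (r : seq I) (P : pred I)
    (f : 'Hom(V, W)) (g : I -> 'Hom(U, V)) :
  (f \o (\sum_(i <- r | P i) g i) = \sum_(i <- r | P i) (f \o g i))%VF.
Proof.
apply: (big_morph (fun h => f \o h)%VF) => [x y|]; first exact: comp_lfunDr.
exact: comp_lfun0r.
Qed.

Lemma v2r_lfun V W (f : 'Hom(V, W)) v : v2r (f v) = v2r v *m f2mx f.
Proof. by rewrite unlock /= r2vK. Qed.

Lemma f2mx_comp U V W (f : 'Hom(V, W)) (g : 'Hom(U, V)) :
  f2mx (f \o g)%VF = f2mx g *m f2mx f.
Proof.
apply/row_matrixP=> i; rewrite row_mul !rowE.
by rewrite -[delta_mx 0 i]r2vK -!v2r_lfun comp_lfunE.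
Qed.

Lemma f2mx1 V : f2mx (\1%VF : 'End(V)) = 1%:M.
Proof.
apply/row_matrixP=> i; rewrite !rowE mulmx1.
by rewrite -[delta_mx 0 i]r2vK -!v2r_lfun id_lfunE.
Qed.

Lemma f2mxD V W (f g : 'Hom(V, W)) : f2mx (f + g) = f2mx f + f2mx g.
Proof.
apply/row_matrixP=> i; rewrite linearD /= !rowE.
by rewrite -[delta_mx 0 i]r2vK -!v2r_lfun add_lfunE linearD.
Qed.

Lemma f2mxZ V W c (f : 'Hom(V, W)) : f2mx (c *: f) = c *: f2mx f.
Proof.
apply/row_matrixP=> i; rewrite linearZ /= !rowE.
by rewrite -[delta_mx 0 i]r2vK -!v2r_lfun scale_lfunE linearZ.
Qed.

Lemma f2mx_inj V W : injective (@f2mx K V W).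
Proof. exact: val_inj. Qed.

Definition ltr V (f : 'End(V)) : K := \tr (f2mx f).

Lemma ltrC V W (f : 'Hom(V, W)) (g : 'Hom(W, V)) :
  ltr (f \o g)%VF = ltr (g \o f)%VF.
Proof. by rewrite /ltr !f2mx_comp mxtrace_mulC. Qed.

Fact ltr_is_linear V : linear_for *%R (@ltr V).
Proof. by move=> c f g; rewrite /ltr f2mxD f2mxZ linearP. Qed.
HB.instance Definition _ V :=
  GRing.isLinear.Build K 'End(V) K _ (@ltr V) (@ltr_is_linear V).

Lemma ltr1 V : ltr (\1%VF : 'End(V)) = (\dim {:V})%:R.
Proof. by rewrite /ltr f2mx1 mxtrace1 dimvf. Qed.

Lemma lfun_regularE (f : 'End(K^o)) : f = (f 1 : K) *: \1%VF.
Proof.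
apply/lfunP=> x; rewrite scale_lfunE id_lfunE -[x in LHS]mulr1.
by rewrite -[x * 1]/(x *: (1 : K^o)) linearZ /= [RHS]mulrC.
Qed.

Lemma ltr_regular (f : 'End(K^o)) : ltr f = f 1.
Proof. by rewrite {1}[f]lfun_regularE linearZ /= ltr1 dimvf /dim /= mulr1. Qed.

Lemma ltr_rank1 V (phi : 'Hom(V, K^o)) (w : V) (f : 'End(V)) :
  (forall v, f v = (phi v : K) *: w) -> ltr f = phi w.
Proof.
move=> fE; have lin_w : linear (fun c : K^o => c *: w).
  by move=> a b c; rewrite scalerDl scalerA.
have -> : f = (linfun (fun c : K^o => c *: w) \o phi)%VF.
  by apply/lfunP=> v; rewrite comp_lfunE linfunK.
by rewrite ltrC ltr_regular comp_lfunE linfunK // scale1r.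
Qed.

(** In a rank factorization A = C B, idempotence and cancellation of the full-rank factors give B C
    = 1, whose trace is the rank. *)
Lemma mxtrace_idem n (A : 'M[K]_n) : A *m A = A -> \tr A = (\rank A)%:R.
Proof.
move=> AA; rewrite -{1}[A]mulmx_base mxtrace_mulC.
suff -> : row_base A *m col_base A = 1%:M by rewrite mxtrace1.
have free : row_free (row_base A) by rewrite row_base_free.
have full : row_full (col_base A) by rewrite col_base_full.
apply: (row_free_inj free); apply: (row_full_inj full).
rewrite mul1mx -mulmxA (mulmx_base A) mulmxA (mulmx_base A). exact: AA.
Qed.

Lemma ltr_idem V (f : 'End(V)) : (f \o f = f)%VF -> exists m : nat, ltr f = m%:R.
Proof.
move=> ff; exists (\rank (f2mx f)); apply: mxtrace_idem.
by rewrite -f2mx_comp ff.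
Qed.

End LfunTrace.

Section TensorOps.
Variable K : fieldType.
Implicit Types U V W Z : vectType K.

Lemma pure_is_linearl V W (w : W) : linear (fun v : V => pure v w).
Proof.
move=> c x y; apply/lfunP=> p; rewrite !pureE lfun_combE !pureE linearP.
by rewrite scalerDl scalerA.
Qed.

Lemma pure_is_linearr V W (v : V) : linear (fun w : W => pure v w).
Proof.
move=> c x y; apply/lfunP=> p; rewrite lfun_combE !pureE.
by rewrite scalerDr !scalerA mulrC.
Qed.

Lemma pureDl V W (w : W) (x y : V) : pure (x + y) w = pure x w + pure y w.
Proof. by have := pure_is_linearl w 1 x y; rewrite !scale1r. Qed.

Lemma pure0l V W (w : W) : pure (0 : V) w = 0.
Proof. by apply/lfunP=> p; rewrite pureE linear0 scale0r zero_lfunE. Qed.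

Lemma pureZl V W (w : W) c (x : V) : pure (c *: x) w = c *: pure x w.
Proof. by apply/lfunP=> p; rewrite scale_lfunE !pureE linearZ scalerA. Qed.

Lemma pureZr V W (v : V) c (x : W) : pure v (c *: x) = c *: pure v x.
Proof. by apply/lfunP=> p; rewrite scale_lfunE !pureE !scalerA mulrC. Qed.

Lemma pure_suml V W I (r : seq I) (P : pred I) (F : I -> V) (w : W) :
  pure (\sum_(i <- r | P i) F i) w = \sum_(i <- r | P i) pure (F i) w.
Proof.
by apply: (big_morph (fun v => pure v w)) => [x y|]; rewrite ?pureDl ?pure0l.
Qed.

(** Insertion of [v] and contraction with [phi] on the left factor. They turn the partial trace into
    a sum of composites, so that it can be handled without elements. *)
Definition inn V W (v : V) : 'Hom(W, tensor V W) := linfun (pure v).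
Definition out V W (phi : 'Hom(V, K^o)) : 'Hom(tensor V W, W) :=
  linfun (fun T : tensor V W => T phi).

Lemma innE V W (v : V) (w : W) : inn W v w = pure v w.
Proof. by rewrite linfunK //; exact: pure_is_linearr. Qed.

Lemma outE V W phi (T : tensor V W) : out W phi T = T phi.
Proof. by rewrite linfunK // => c x y; rewrite lfun_combE. Qed.

(** A resolution of the identity, which by itself determines traces and partial traces. Instances
    are [vbasis] with its coordinates, orthonormal bases and eigenbases of T. *)
Definition is_frame d V (e : 'I_d -> V) (e' : 'I_d -> 'Hom(V, K^o)) :=
  forall v, \sum_i (e' i v : K) *: e i = v.

Definition bvec V (i : 'I_(\dim {:V})) : V := (vbasis {:V})`_i.
Definition bdual V (i : 'I_(\dim {:V})) : 'Hom(V, K^o) :=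
  linfun (coord (vbasis {:V}) i : V -> K^o).

Lemma bdualE V i (v : V) : bdual i v = coord (vbasis {:V}) i v.
Proof. by rewrite linfunK //; exact: linearP. Qed.

Lemma bvec_frame V : is_frame (@bvec V) (@bdual V).
Proof.
by move=> v; rewrite {2}(coord_vbasis (memvf v)); apply: eq_bigr => i _; rewrite bdualE.
Qed.

Lemma frame_dual d V (e : 'I_d -> V) e' (phi : 'Hom(V, K^o)) :
  is_frame e e' -> phi = \sum_i (phi (e i) : K) *: e' i.
Proof.
move=> eP; apply/lfunP=> v; rewrite -{1}[v]eP linear_sum sum_lfunE.
by apply: eq_bigr => i _; rewrite linearZ scale_lfunE [LHS]mulrC.
Qed.

Lemma tensor_frame d V W (e : 'I_d -> V) e' (X : tensor V W) :
  is_frame e e' -> \sum_i pure (e i) (X (e' i)) = X.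
Proof.
move=> eP; apply/lfunP=> phi; rewrite sum_lfunE [in RHS](frame_dual phi eP) linear_sum.
by apply: eq_bigr => i _; rewrite pureE linearZ.
Qed.

Lemma frame_id d V W (e : 'I_d -> V) e' : is_frame e e' ->
  (\sum_i (inn W (e i) \o out W (e' i)) = \1)%VF.
Proof.
move=> eP; apply/lfunP=> X; rewrite sum_lfunE id_lfunE -[RHS](tensor_frame X eP).
by apply: eq_bigr => i _; rewrite comp_lfunE innE outE.
Qed.

Lemma tensor_ext V W U (f g : 'Hom(tensor V W, U)) :
  (forall v w, f (pure v w) = g (pure v w)) -> f = g.
Proof.
move=> fg; apply/lfunP=> X; rewrite -(tensor_frame X (@bvec_frame V)) !linear_sum.
by apply: eq_bigr => i _; apply: fg.
Qed.

Lemma tensor_ext3 V W U Z (f g : 'Hom(tensor (tensor V W) U, Z)) :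
  (forall v w u, f (pure (pure v w) u) = g (pure (pure v w) u)) -> f = g.
Proof.
move=> fg; apply: tensor_ext => X u; rewrite -(tensor_frame X (@bvec_frame V)).
by rewrite pure_suml !linear_sum; apply: eq_bigr => i _; apply: fg.
Qed.

Lemma tensor_ext3r V W U Z (f g : 'Hom(tensor V (tensor W U), Z)) :
  (forall v w u, f (pure v (pure w u)) = g (pure v (pure w u))) -> f = g.
Proof.
move=> fg; apply: tensor_ext => v X.
suff H : (f \o inn _ v = g \o inn _ v)%VF by rewrite -!innE -!comp_lfunE H.
by apply: tensor_ext => w u; rewrite !comp_lfunE !innE.
Qed.

Lemma tensor_map_comp V V' V'' W W' W'' (f : 'Hom(V', V'')) (f' : 'Hom(V, V'))
    (g : 'Hom(W', W'')) (g' : 'Hom(W, W')) :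
  (tensor_map f g \o tensor_map f' g' = tensor_map (f \o f') (g \o g'))%VF.
Proof. by apply: tensor_ext => v w; rewrite !(comp_lfunE, tensor_map_pure). Qed.

Lemma tensor_map1 V W : tensor_map \1%VF \1%VF = \1%VF :> 'End(tensor V W).
Proof. by apply: tensor_ext => v w; rewrite tensor_map_pure !id_lfunE. Qed.

Lemma tensor_map_inn V V' W W' (f : 'Hom(V, V')) (g : 'Hom(W, W')) v :
  (tensor_map f g \o inn W v = inn W' (f v) \o g)%VF.
Proof. by apply/lfunP=> w; rewrite !comp_lfunE !innE tensor_map_pure. Qed.

Lemma out_tensor_map V V' W W' (f : 'Hom(V, V')) (g : 'Hom(W, W')) phi :
  (out W' phi \o tensor_map f g = g \o out W (phi \o f))%VF.
Proof. by apply/lfunP=> T; rewrite !comp_lfunE !outE tensor_mapE. Qed.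

Lemma tensor_mapZr V W c (f : 'End(V)) (g : 'End(W)) :
  tensor_map f (c *: g) = c *: tensor_map f g.
Proof.
by apply: tensor_ext => v w; rewrite scale_lfunE !tensor_map_pure scale_lfunE pureZr.
Qed.

Lemma tensor_mapZl V W c (f : 'End(V)) (g : 'End(W)) :
  tensor_map (c *: f) g = c *: tensor_map f g.
Proof.
by apply: tensor_ext => v w; rewrite scale_lfunE !tensor_map_pure scale_lfunE pureZl.
Qed.

(** Injectivity makes [^-1] a genuine left inverse. It follows from an explicit left inverse [b],
    written in bases of U and V. *)
Lemma tensor_assoc_lker U V W : lker (tensor_assoc U V W) == 0%VS.
Proof.
pose b := \sum_i \sum_j (linfun (fun Y : tensor U (tensor V W) =>
   pure (pure (bvec i) (bvec j)) (Y (@bdual U i) (@bdual V j))))%VF.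
suff ba : (b \o tensor_assoc U V W)%VF = \1%VF.
  apply/lker0P => x y /(congr1 b); rewrite -!comp_lfunE ba !id_lfunE //.
have E i j Y : linfun (fun Y : tensor U (tensor V W) =>
   pure (pure (bvec i) (bvec j)) (Y (@bdual U i) (@bdual V j))) Y =
   pure (pure (bvec i) (bvec j)) (Y (@bdual U i) (@bdual V j)).
  rewrite linfunK // => c X Z; rewrite !lfun_combE.
  exact: (pure_is_linearr (pure (bvec i) (bvec j))).
apply: tensor_ext3 => u v w; rewrite comp_lfunE tensor_assoc_pure id_lfunE.
rewrite sum_lfunE -[in RHS](bvec_frame u) pure_suml pure_suml; apply: eq_bigr => i _.
rewrite sum_lfunE.
transitivity (inn W (pure ((bdual i u : K) *: bvec i) v) w); last by rewrite innE.
rewrite -[in RHS](bvec_frame v).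
transitivity ((\sum_j inn W (pure ((bdual i u : K) *: bvec i) ((bdual j v : K) *: bvec j))) w).
  rewrite sum_lfunE; apply: eq_bigr => j _; rewrite E innE !pureE.
  by rewrite scale_lfunE pureE !pureZr !pureZl !scalerA mulrC.
rewrite sum_lfunE [RHS]innE -[pure _ (\sum_i _)]innE linear_sum /= pure_suml.
by apply: eq_bigr => j _; rewrite !innE.
Qed.

Lemma tensor_assocV_pure U V W (u : U) (v : V) (w : W) :
  ((tensor_assoc U V W)^-1)%VF (pure u (pure v w)) = pure (pure u v) w.
Proof.
by rewrite -tensor_assoc_pure lker0_lfunK //; exact: tensor_assoc_lker.
Qed.

Lemma tensor_assocVK U V W :
  (tensor_assoc U V W \o (tensor_assoc U V W)^-1 = \1)%VF.
Proof.
apply: tensor_ext3r => u v w.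
by rewrite comp_lfunE tensor_assocV_pure tensor_assoc_pure id_lfunE.
Qed.

Lemma tensor_assocK U V W :
  ((tensor_assoc U V W)^-1 \o tensor_assoc U V W = \1)%VF.
Proof. by apply: lker0_compVf; exact: tensor_assoc_lker. Qed.

(* The partial trace over the left factor. *)
Definition ptr V W (Z : 'End(tensor V W)) : 'End(W) :=
  (\sum_i (out W (@bdual V i) \o Z \o inn W (bvec i)))%VF.

(** Basis independence of the partial trace: expand [bvec i] in the frame, then collect the dual
    vectors into [e' j]. *)
Lemma ptr_frameE d V W (e : 'I_d -> V) e' (Z : 'End(tensor V W)) w :
  is_frame e e' -> ptr Z w = \sum_i Z (pure (e i) w) (e' i).
Proof.
move=> eP; rewrite sum_lfunE.
transitivity (\sum_(i < \dim {:V}) \sum_(j < d)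
    (e' j (bvec i) : K) *: Z (pure (e j) w) (bdual i)).
  apply: eq_bigr => i _; rewrite !comp_lfunE innE outE.
  rewrite -[in LHS](eP (bvec i)) pure_suml linear_sum sum_lfunE.
  by apply: eq_bigr => j _; rewrite pureZl linearZ scale_lfunE.
rewrite exchange_big; apply: eq_bigr => j _ /=.
rewrite [in RHS](frame_dual (e' j) (@bvec_frame V)) linear_sum.
by apply: eq_bigr => i _; rewrite linearZ.
Qed.

Lemma ltr_ptr V W (Z : 'End(tensor V W)) : ltr (ptr Z) = ltr Z.
Proof.
rewrite -[Z in RHS]comp_lfun1r -(frame_id W (@bvec_frame V)) comp_lfun_sumr /ptr !linear_sum /=.
by apply: eq_bigr => i _; rewrite [in RHS]comp_lfunA [RHS]ltrC comp_lfunA.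
Qed.

Lemma ptr_compr V W (Z : 'End(tensor V W)) X :
  ptr (Z \o tensor_map \1 X)%VF = (ptr Z \o X)%VF.
Proof.
rewrite comp_lfun_suml; apply: eq_bigr => i _.
by rewrite -!comp_lfunA tensor_map_inn id_lfunE.
Qed.

Lemma ptr_compl V W (Z : 'End(tensor V W)) X :
  ptr (tensor_map \1 X \o Z)%VF = (X \o ptr Z)%VF.
Proof.
rewrite comp_lfun_sumr; apply: eq_bigr => i _.
by rewrite !comp_lfunA out_tensor_map comp_lfun1r.
Qed.

Lemma ltr_frame d V (e : 'I_d -> V) e' (f : 'End(V)) :
  is_frame e e' -> ltr f = \sum_i (e' i (f (e i)) : K).
Proof.
move=> eP; have lin_e i : linear (fun c : K^o => c *: e i).
  by move=> a b c; rewrite scalerDl scalerA.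
have fE : f = (\sum_i (f \o linfun (fun c : K^o => c *: e i) \o e' i))%VF.
  apply/lfunP=> v; rewrite -{1}[v]eP linear_sum sum_lfunE; apply: eq_bigr => i _.
  by rewrite !comp_lfunE linfunK.
rewrite {1}fE linear_sum /=; apply: eq_bigr => i _.
by apply: ltr_rank1 => v; rewrite !comp_lfunE linfunK // linearZ /=.
Qed.

Lemma ptr_map V W (f : 'End(V)) (g : 'End(W)) :
  ptr (tensor_map f g) = ltr f *: g.
Proof.
apply/lfunP=> w; rewrite (ptr_frameE _ _ (@bvec_frame V)) scale_lfunE.
rewrite (ltr_frame _ (@bvec_frame V)) scaler_suml; apply: eq_bigr => i _.
by rewrite tensor_map_pure pureE.
Qed.

Lemma ltr_map V W (f : 'End(V)) (g : 'End(W)) :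
  ltr (tensor_map f g) = ltr f * ltr g.
Proof. by rewrite -ltr_ptr ptr_map linearZ. Qed.

Fact amp_key : unit. Proof. by []. Qed.

(* A (x) 1_W carried to the right-nested V (x) (V (x) W); locked, lest
   [comp_lfunE] unfold it. *)
Definition amp V W (A : 'End(tensor V V)) : 'End(tensor V (tensor V W)) :=
  locked_with amp_key
    (tensor_assoc V V W \o tensor_map A \1 \o (tensor_assoc V V W)^-1)%VF.

Lemma ampE V W (A : 'End(tensor V V)) :
  amp W A = (tensor_assoc V V W \o tensor_map A \1 \o (tensor_assoc V V W)^-1)%VF.
Proof. by rewrite /amp unlock. Qed.

Lemma amp_inn V W (A : 'End(tensor V V)) (X : tensor V V) w :
  amp W A (tensor_assoc V V W (pure X w)) = tensor_assoc V V W (pure (A X) w).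
Proof.
rewrite ampE !comp_lfunE lker0_lfunK ?tensor_assoc_lker //.
by rewrite tensor_map_pure id_lfunE.
Qed.

Lemma amp_pure V W (A : 'End(tensor V V)) u v w :
  amp W A (pure u (pure v w)) = tensor_assoc V V W (pure (A (pure u v)) w).
Proof. by rewrite -tensor_assoc_pure amp_inn. Qed.

Lemma amp_comp V W (A B : 'End(tensor V V)) :
  amp W (A \o B)%VF = (amp W A \o amp W B)%VF.
Proof.
by apply: tensor_ext3r => u v w; rewrite comp_lfunE !amp_pure amp_inn comp_lfunE.
Qed.

Lemma amp1 V W : amp W (\1%VF : 'End(tensor V V)) = \1%VF.
Proof.
by apply: tensor_ext3r => u v w; rewrite amp_pure !id_lfunE tensor_assoc_pure.
Qed.

Lemma amp_map V W (f g : 'End(V)) :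
  amp W (tensor_map f g) = tensor_map f (tensor_map g \1).
Proof.
apply: tensor_ext3r => u v w.
by rewrite amp_pure !tensor_map_pure id_lfunE tensor_assoc_pure.
Qed.

Lemma amp_lft V W Z (A : 'End(tensor V V)) (X : 'Hom(W, Z)) :
  (amp Z A \o tensor_map \1 (tensor_map \1 X) =
   tensor_map \1 (tensor_map \1 X) \o amp W A)%VF.
Proof.
apply: tensor_ext3r => u v w.
rewrite !comp_lfunE !tensor_map_pure !id_lfunE !amp_pure.
rewrite -[A _](tensor_frame _ (@bvec_frame V)) !pure_suml !linear_sum /=.
apply: eq_bigr => i _.
by rewrite !tensor_assoc_pure !tensor_map_pure !id_lfunE.
Qed.

Lemma ptr_amp V W (A : 'End(tensor V V)) :
  ptr (amp W A) = tensor_map (ptr A) \1.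
Proof.
apply: tensor_ext => v w; rewrite tensor_map_pure id_lfunE.
rewrite !(ptr_frameE _ _ (@bvec_frame V)) pure_suml; apply: eq_bigr => i _.
rewrite amp_pure; move: (A _) => X.
rewrite -[X](tensor_frame _ (@bvec_frame V)).
rewrite !pure_suml linear_sum !sum_lfunE pure_suml; apply: eq_bigr => j _ /=.
by rewrite tensor_assoc_pure !pureE pureZl.
Qed.

(* Y (x) 1_W in the right-nested V (x) (V (x) (V (x) W)). *)
Definition amp3 V W (Y : 'End(tensor V (tensor V V))) :
    'End(tensor V (tensor V (tensor V W))) :=
  let b := (tensor_map \1 (tensor_assoc V V W) \o tensor_assoc V (tensor V V) W)%VF in
  let b' := ((tensor_assoc V (tensor V V) W)^-1 \o tensor_map \1 (tensor_assoc V V W)^-1)%VF in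
  (b \o tensor_map Y \1 \o b')%VF.

(** Multiplicativity carries the braid relation from three sites to three sites followed by an
    arbitrary space. *)
Lemma amp3_comp V W (A B : 'End(tensor V (tensor V V))) :
  amp3 W (A \o B)%VF = (amp3 W A \o amp3 W B)%VF.
Proof.
rewrite /amp3; set a := tensor_assoc _ _ _; set c := tensor_assoc _ _ _.
rewrite -!comp_lfunA; congr (_ \o (_ \o _))%VF.
rewrite [in RHS](comp_lfunA (tensor_map _ (a^-1)%VF)) tensor_map_comp comp_lfun1l.
rewrite tensor_assocK tensor_map1 comp_lfun1l.
rewrite (comp_lfunA (c^-1)%VF) tensor_assocK comp_lfun1l.
by rewrite comp_lfunA tensor_map_comp comp_lfun1l.
Qed.

Lemma amp3_pure V W (A : 'End(tensor V (tensor V V))) u v x w :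
  amp3 W A (pure u (pure v (pure x w))) =
  tensor_map \1 (tensor_assoc V V W)
    (tensor_assoc V (tensor V V) W (pure (A (pure u (pure v x))) w)).
Proof.
rewrite /amp3 !comp_lfunE tensor_map_pure tensor_assocV_pure id_lfunE.
by rewrite tensor_assocV_pure tensor_map_pure id_lfunE.
Qed.

Lemma tensor_ext4r V W U Z Z' (f g : 'Hom(tensor V (tensor W (tensor U Z)), Z')) :
  (forall v w u z, f (pure v (pure w (pure u z))) = g (pure v (pure w (pure u z)))) ->
  f = g.
Proof.
move=> fg; apply: tensor_ext => v X.
suff H : (f \o inn _ v = g \o inn _ v)%VF by rewrite -!innE -!comp_lfunE H.
by apply: tensor_ext3r => w u z; rewrite !comp_lfunE !innE.
Qed.

Lemma amp3_amp V W (A : 'End(tensor V V)) : amp3 W (amp V A) = amp (tensor V W) A.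
Proof.
apply: tensor_ext4r => u v x w; rewrite amp3_pure !amp_pure.
rewrite -[A _](tensor_frame _ (@bvec_frame V)).
do ![rewrite ?pure_suml ?linear_sum /=]; apply: eq_bigr => i _.
by rewrite !tensor_assoc_pure tensor_map_pure tensor_assoc_pure id_lfunE.
Qed.

Lemma amp3_rgt V W (A : 'End(tensor V V)) :
  amp3 W (tensor_map \1 A)%VF = tensor_map \1%VF (amp W A).
Proof.
apply: tensor_ext4r => u v x w; rewrite amp3_pure !tensor_map_pure amp_pure.
by rewrite tensor_assoc_pure tensor_map_pure !id_lfunE.
Qed.

(** Conjugation by the associator moves the relation from the left-nested cube to the right-nested
    one, the shape of [tensor_pow]. *)
Lemma yang_baxter3 V (A : 'End(tensor V V)) : yang_baxter A ->
  let s0 := amp V A in let s1 := tensor_map \1%VF A in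
  (s0 \o s1 \o s0 = s1 \o s0 \o s1)%VF.
Proof.
rewrite /yang_baxter /=; set a := tensor_assoc V V V => YB.
have {YB} := congr1 (fun h => a \o h \o a^-1)%VF YB.
have aK : (a \o a^-1 = \1)%VF by exact: tensor_assocVK.
rewrite ampE -/a !comp_lfunA aK comp_lfun1l.
rewrite -!comp_lfunA aK comp_lfun1r !comp_lfunA => ->.
by rewrite -!comp_lfunA.
Qed.

Lemma yang_baxter_amp V W (A : 'End(tensor V V)) : yang_baxter A ->
  let s0 := amp (tensor V W) A in let s1 := tensor_map \1%VF (amp W A) in
  (s0 \o s1 \o s0 = s1 \o s0 \o s1)%VF.
Proof.
by move=> /yang_baxter3 /= YB; rewrite -amp3_amp -amp3_rgt -!amp3_comp YB.
Qed.

End TensorOps.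

(** * Orthonormal bases and self-adjoint operators *)


Section Orthonormal.
Variables (K : numClosedFieldType) (V : hilbert K).
Local Notation "<< u , v >>" := (inner V u v).
Local Notation d := (\dim {:V}).

Definition onb (e : 'I_d -> V) := forall i j, << e i, e j >> = (i == j)%:R.

(** Gram-Schmidt: an orthonormal family of fewer than dim V vectors misses some [v], whose component
    orthogonal to the family is nonzero and gets normalized. *)
Lemma onb_exists : exists e : 'I_d -> V, onb e.
Proof.
suff [s [sz sP]] : exists s : seq V, size s = d /\
    forall i j, (i < size s)%N -> (j < size s)%N -> << s`_i, s`_j >> = (i == j)%:R.
  by exists (fun i => s`_i) => i j; rewrite sP ?sz // -val_eqE.
have : (d <= d)%N by []; move: {1 3}d => k; elim: k => [|k IH] kd; first by exists [::]; split.
have [s [sz sP]] := IH (ltnW kd).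
have /subvPn [v _ vs] : ~~ ({:V} <= <<s>>)%VS.
  apply: contraL kd => /dimvS le_d; rewrite -leqNgt (leq_trans le_d) //.
  by rewrite (leq_trans (dim_span _)) ?sz.
have [X Xs [Y [vE _ /orthoPl Ys]]] := orthogonal_split (inner V) s v.
have Y0 : Y != 0 by apply: contraNneq vs => Y0; rewrite vE Y0 addr0.
pose c := (sqrtC << Y, Y >>)^-1.
have cE : c * c^* * << Y, Y >> = 1.
  have Yp : 0 < << Y, Y >> by rewrite dnorm_gt0.
  have cr : c^* = c by rewrite conj_Creal // realV ger0_real // sqrtC_ge0 ltW.
  by rewrite cr -expr2 exprVn sqrtCK mulVf ?gt_eqF.
exists ((c *: Y) :: s); split=> [|[|i] [|j]] /=; rewrite ?sz // ?ltnS => ip jp.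
- by rewrite linearZl_LR linearZr_LR /= mulrA.
- by rewrite linearZl_LR /= Ys ?mulr0 // mem_nth ?sz.
- by rewrite linearZr_LR /= hermC /= expr0 mul1r Ys ?conjC0 ?mulr0 // mem_nth ?sz.
by rewrite sP ?sz.
Qed.

Variables (e : 'I_d -> V) (eP : onb e).

Definition odual (i : 'I_d) : 'Hom(V, K^o) := linfun (fun v : V => << v, e i >> : K^o).

Lemma odualE i v : odual i v = << v, e i >>.
Proof. by rewrite linfunK // => c x y; rewrite linearPl. Qed.

Lemma odual_onb i j : odual i (e j) = (i == j)%:R.
Proof. by rewrite odualE eP eq_sym. Qed.

(** Orthonormal vectors are free, and there are dim V of them. *)
Lemma onb_frame : is_frame e odual.
Proof.
pose s := [tuple e i | i < d].
have ns (i : 'I_d) : s`_i = e i by rewrite -tnth_nth tnth_mktuple.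
have c_dual (c : 'I_d -> K) j : odual j (\sum_i c i *: s`_i) = c j.
  rewrite linear_sum (bigD1 j) //= big1 => [|i ij]; rewrite linearZ /= ns odual_onb.
    by rewrite eqxx addr0 [LHS]mulr1.
  by rewrite eq_sym (negPf ij) [LHS]mulr0.
have fs : free s.
  apply/freeP => c c0 i; rewrite -(c_dual c i) c0 linear0 //.
have bs : basis_of {:V} s by rewrite basisEfree fs subvf size_tuple leqnn.
move=> v; rewrite [RHS](coord_basis bs (memvf v)); apply: eq_bigr => i _.
by rewrite [in LHS](coord_basis bs (memvf v)) c_dual ns.
Qed.

Lemma tensor_inner_suml I (r : seq I) (P : pred I) (F : I -> tensor V V) T :
  tensor_inner (\sum_(i <- r | P i) F i) T = \sum_(i <- r | P i) tensor_inner (F i) T.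
Proof.
apply: (big_morph (fun S : tensor V V => tensor_inner S T)) => [x y|].
  rewrite /tensor_inner -big_split; apply: eq_bigr => i _.
  rewrite -big_split; apply: eq_bigr => j _ /=.
  by rewrite add_lfunE linearDl mulrDr.
rewrite /tensor_inner big1 // => i _; rewrite big1 // => j _.
by rewrite zero_lfunE linear0l mulr0.
Qed.

Lemma tensor_inner_sumr I (r : seq I) (P : pred I) (F : I -> tensor V V) S :
  tensor_inner S (\sum_(i <- r | P i) F i) = \sum_(i <- r | P i) tensor_inner S (F i).
Proof.
apply: (big_morph (fun T : tensor V V => tensor_inner S T)) => [x y|].
  rewrite /tensor_inner -big_split; apply: eq_bigr => i _.
  rewrite -big_split; apply: eq_bigr => j _ /=.
  by rewrite add_lfunE linearDr mulrDr.
rewrite /tensor_inner big1 // => i _; rewrite big1 // => j _.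
by rewrite zero_lfunE linear0r mulr0.
Qed.

(** In an orthonormal basis the defining double sum becomes diagonal, and positivity can be read
    off. *)
Lemma tensor_inner_onb (S T : tensor V V) :
  tensor_inner S T = \sum_i << S (odual i), T (odual i) >>.
Proof.
rewrite -{1}[S](tensor_frame _ onb_frame) -{1}[T](tensor_frame _ onb_frame).
rewrite tensor_inner_suml; apply: eq_bigr => i _; rewrite tensor_inner_sumr.
rewrite (bigD1 i) //= big1 => [|j ij]; rewrite tensor_inner_pure eP.
  by rewrite eqxx mul1r addr0.
by rewrite eq_sym (negPf ij) mul0r.
Qed.

Lemma tensor_inner_purer (S : tensor V V) i w :
  tensor_inner S (pure (e i) w) = << S (odual i), w >>.
Proof.
rewrite tensor_inner_onb (bigD1 i) //= big1 => [|j ij]; rewrite pureE odual_onb.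
  by rewrite eqxx scale1r addr0.
by rewrite (negPf ij) scale0r linear0r.
Qed.

Lemma tensor_inner_purel (S : tensor V V) i w :
  tensor_inner (pure (e i) w) S = << w, S (odual i) >>.
Proof.
rewrite tensor_inner_onb (bigD1 i) //= big1 => [|j ij]; rewrite pureE odual_onb.
  by rewrite eqxx scale1r addr0.
by rewrite (negPf ij) scale0r linear0l.
Qed.

Definition selfadj (f : 'End(V)) := forall v w, << f v, w >> = << v, f w >>.
Definition selfadj2 (f : 'End(tensor V V)) :=
  forall S T, tensor_inner (f S) T = tensor_inner S (f T).

Lemma unitary_invol_selfadj (A : 'End(tensor V V)) :
  unitary A -> (A \o A = \1)%VF -> selfadj2 A.
Proof.
by move=> uA AA S T; rewrite -uA -[A (A S)]comp_lfunE AA id_lfunE.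
Qed.

Lemma ptr_selfadj (A : 'End(tensor V V)) : selfadj2 A -> selfadj (ptr A).
Proof.
move=> sA v w; rewrite !(ptr_frameE _ _ onb_frame) linear_sumlz linear_sumr.
by apply: eq_bigr => i _ /=; rewrite -tensor_inner_purer sA tensor_inner_purel.
Qed.

Lemma tensor_map_selfadj f g : selfadj f -> selfadj g -> selfadj2 (tensor_map f g).
Proof.
move=> sf sg S T; rewrite -[S](tensor_frame _ onb_frame) -[T](tensor_frame _ onb_frame).
rewrite !linear_sum !tensor_inner_suml; apply: eq_bigr => i _ /=.
rewrite !tensor_inner_sumr; apply: eq_bigr => j _ /=.
by rewrite !tensor_map_pure !tensor_inner_pure sf sg.
Qed.

Lemma ltr_onb2 (Z : 'End(tensor V V)) :
  ltr Z = \sum_j \sum_i tensor_inner (Z (pure (e i) (e j))) (pure (e i) (e j)).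
Proof.
rewrite -ltr_ptr (ltr_frame _ onb_frame); apply: eq_bigr => j _.
rewrite (ptr_frameE _ _ onb_frame) linear_sum; apply: eq_bigr => i _ /=.
by rewrite odualE tensor_inner_purer.
Qed.

(** By self-adjointness the trace of X^2 is the sum of the squared norms of the X(e_i (x) e_j). *)
Lemma selfadj2_tr0 (X : 'End(tensor V V)) :
  selfadj2 X -> ltr (X \o X)%VF = 0 -> X = 0.
Proof.
move=> sX; rewrite ltr_onb2 => X0.
have Xe i j : X (pure (e i) (e j)) = 0.
  pose XX k l := tensor_inner ((X \o X)%VF (pure (e k) (e l))) (pure (e k) (e l)).
  have XX_ge0 k l : 0 <= XX k l.
    by rewrite /XX comp_lfunE sX tensor_inner_onb sumr_ge0 // => m _; rewrite dnorm_ge0.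
  have /psumr_eq0P : \sum_k XX k j = 0.
    by move/psumr_eq0P: X0 => -> // k _; rewrite sumr_ge0 // => l _; apply: XX_ge0.
  move=> /(_ (fun k _ => XX_ge0 k j) i isT); rewrite /XX comp_lfunE sX; set S := X _.
  rewrite tensor_inner_onb => /psumr_eq0P S0.
  rewrite -[S](tensor_frame _ onb_frame) big1 // => k _.
  have /eqP := S0 (fun k _ => dnorm_ge0 _ _) k isT.
  by rewrite dnorm_eq0 => /eqP ->; rewrite -innE linear0.
apply: tensor_ext => v w; rewrite zero_lfunE -[v]onb_frame pure_suml linear_sum.
rewrite big1 // => i _ /=; rewrite -[w]onb_frame -innE !linear_sum big1 // => j _ /=.
by rewrite innE pureZl pureZr !linearZ /= Xe !scaler0.
Qed.

(** The matrix M of f acts on coordinate rows and is Hermitian. From P M = D P, the rows of the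
    unitary P are the coordinates of eigenvectors. *)
Lemma selfadj_spectral (f : 'End(V)) : selfadj f ->
  exists (u : 'I_d -> V) (t : 'I_d -> K), onb u /\ forall i, f (u i) = t i *: u i.
Proof.
move=> sf; pose M := \matrix_(i, j) << f (e i), e j >>.
have Me i : f (e i) = \sum_j M i j *: e j.
  rewrite -{1}[f (e i)]onb_frame; apply: eq_bigr => j _.
  by rewrite odualE mxE.
have Mn : M \is normalmx.
  apply: hermitian_normalmx; apply/is_hermitianmxP; rewrite expr0 scale1r.
  by apply/matrixP=> i j; rewrite !mxE sf hermC expr0 mul1r.
have Pu := spectral_unitarymx M; move: (spectral_unit M) => Pi.
move/orthomx_spectralP: Mn; move: (spectralmx M) (spectral_diag M) Pu Pi => P D Pu Pi ME.
exists (fun k => \sum_j P k j *: e j), (fun k => D 0 k); split=> [k l|k].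
  have /unitarymxP/matrixP/(_ k l) := Pu; rewrite !mxE => <-.
  rewrite linear_sumlz; apply: eq_bigr => i _; rewrite linear_sumr (bigD1 i) //=.
  rewrite big1 => [|j ji]; rewrite linearZl_LR linearZr_LR /= eP.
    by rewrite eqxx mulr1 addr0 !mxE.
  by rewrite eq_sym (negPf ji) !mulr0.
have PM : P *m M = diag_mx D *m P by rewrite ME !mulmxA mulmxV // mul1mx.
rewrite linear_sum scaler_sumr.
under eq_bigr => i _ do rewrite linearZ /= Me scaler_sumr.
rewrite exchange_big; apply: eq_bigr => j _ /=.
have /matrixP/(_ k j) := PM; rewrite mul_diag_mx !mxE scalerA => <-.
by rewrite scaler_suml; apply: eq_bigr => i _; rewrite scalerA.
Qed.
End Orthonormal.

(** * The partial trace intertwines *)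


Section Intertwine.
Variables (K : numClosedFieldType) (V : hilbert K) (A : 'End(tensor V V)).
Hypotheses (uA : unitary A) (AA : (A \o A = \1)%VF) (YB : yang_baxter A).
Local Notation T := (ptr A).
Local Notation T1 := (tensor_map T (\1%VF : 'End(V))).
Local Notation T2 := (tensor_map (\1%VF : 'End(V)) T).

(* Compute on three sites, T_1 being the partial trace over site 0 of
   s0 = R_{01}: the braid relation turns the trace of s1 s0 s1 T_2 into that of
   s1 T_2. *)
Lemma ltr_cross : ltr (A \o T1 \o A \o T2)%VF = (\dim {:V})%:R * ltr (T \o T)%VF.
Proof.
pose s0 := amp V A; pose s1 : 'End(tensor V (tensor V V)) := tensor_map \1%VF A.
pose T3 : 'End(tensor V (tensor V V)) := tensor_map \1%VF T2.
have -> : (A \o T1 \o A \o T2)%VF = ptr (s1 \o s0 \o s1 \o T3)%VF.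
  by rewrite (ptr_compr _ T2) (ptr_compr _ A) (ptr_compl _ A) ptr_amp.
have s0s0 : (s0 \o s0 = \1)%VF by rewrite -amp_comp AA amp1.
(* [T3] acts on the last site only and commutes with [s0], so by cyclicity the two outer factors
   [s0] meet and cancel. *)
rewrite ltr_ptr -[(s1 \o s0 \o s1)%VF](yang_baxter3 YB) -/s0 -/s1 -!comp_lfunA ltrC.
rewrite -!comp_lfunA -(amp_lft A T) -/s0 (comp_lfunA s0 s0) s0s0 comp_lfun1l.
rewrite tensor_map_comp comp_lfun1l ltr_map ltr1; congr (_ * _).
by rewrite -ltr_ptr ptr_compr.
Qed.

(** Expanding the trace of X^2 for X = A T_1 A - T_2 gives four traces, each equal to dim V times tr
    T^2 up to sign; the signs cancel. *)
Lemma ptr_intertwines : (A \o T1 = T2 \o A)%VF.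
Proof.
have [e eP] := onb_exists V.
have sA := unitary_invol_selfadj uA AA; have sT := ptr_selfadj eP sA.
pose X : 'End(tensor V V) := ((A \o T1 \o A) - T2)%VF.
suff X0 : X = 0.
  have /eqP := X0; rewrite subr_eq0 => /eqP <-.
  by rewrite -!comp_lfunA AA comp_lfun1r.
have s1 : selfadj (\1%VF : 'End(V)) by move=> v w; rewrite !id_lfunE.
apply: (selfadj2_tr0 eP) => [S U|].
  have sT1 := tensor_map_selfadj eP sT s1; have sT2 := tensor_map_selfadj eP s1 sT.
  rewrite /X !add_lfunE !opp_lfunE !comp_lfunE.
  have tB (P Q Z : tensor V V) : tensor_inner (P - Q) Z = tensor_inner P Z - tensor_inner Q Z.
    by rewrite !(tensor_inner_onb eP) -sumrB; apply: eq_bigr => i _;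
       rewrite add_lfunE opp_lfunE linearBl.
  have tBr (P Q Z : tensor V V) : tensor_inner Z (P - Q) = tensor_inner Z P - tensor_inner Z Q.
    by rewrite !(tensor_inner_onb eP) -sumrB; apply: eq_bigr => i _;
       rewrite add_lfunE opp_lfunE linearBr.
  by rewrite tB tBr sA sT1 sA sT2.
have E1 : ltr (A \o T1 \o A \o (A \o T1 \o A))%VF = (\dim {:V})%:R * ltr (T \o T)%VF.
  rewrite -!comp_lfunA ltrC -!comp_lfunA AA comp_lfun1r (comp_lfunA A A) AA comp_lfun1l.
  by rewrite tensor_map_comp comp_lfun1l ltr_map ltr1 mulrC.
have E2 : ltr (T2 \o T2)%VF = (\dim {:V})%:R * ltr (T \o T)%VF.
  by rewrite tensor_map_comp comp_lfun1l ltr_map ltr1.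
rewrite /X comp_lfunDl !comp_lfunDr !comp_lfunNl !comp_lfunNr opprK !linearD !linearN /=.
by rewrite [ltr (T2 \o _)%VF]ltrC ltr_cross E1 E2 addrA subrK subrr.
Qed.

End Intertwine.

(** * The representations of the symmetric groups *)


Section Perm.

Lemma lift_perm_tail_exists n (s : 'S_n.+1) :
  exists s' : 'S_n, s == lift_perm ord0 (s ord0) s'.
Proof.
have ne i : s (lift ord0 i) != s ord0.
  by rewrite (inj_eq perm_inj) eq_sym neq_lift.
pose f (i : 'I_n) := odflt i (unlift (s ord0) (s (lift ord0 i))).
have fE i : lift (s ord0) (f i) = s (lift ord0 i).
  by rewrite /f; case: unliftP (ne i) => [j -> //|->]; rewrite eqxx.
have f_inj : injective f.
  by move=> i j /(congr1 (lift (s ord0))); rewrite !fE => /perm_inj/lift_inj.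
exists (perm f_inj); apply/eqP/permP=> x; case: (unliftP ord0 x) => [j|] ->.
  by rewrite lift_perm_lift permE fE.
by rewrite lift_perm_id.
Qed.

Definition perm_tail n (s : 'S_n.+1) : 'S_n := xchoose (lift_perm_tail_exists s).

Lemma perm_tailP n (s : 'S_n.+1) : lift_perm ord0 (s ord0) (perm_tail s) = s.
Proof. by rewrite -(eqP (xchooseP (lift_perm_tail_exists s))). Qed.

Lemma lift_perm_inj n (i j : 'I_n.+1) : injective (lift_perm i j).
Proof.
move=> s t st; apply/permP=> x; apply: (@lift_inj _ j).
by rewrite -!(lift_perm_lift i) st.
Qed.

Lemma perm_tail_lift n (k : 'I_n.+1) (s : 'S_n) : perm_tail (lift_perm ord0 k s) = s.
Proof.
have := perm_tailP (lift_perm ord0 k s); rewrite lift_perm_id.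
exact: lift_perm_inj.
Qed.

Lemma lift_perm_tperm n (k : 'I_n.+1) (i j : 'I_n) :
  lift_perm k k (tperm i j) = tperm (lift k i) (lift k j).
Proof.
apply/permP=> x; case: (unliftP k x) => [y|] ->.
  by rewrite lift_perm_lift inj_tperm //; apply: lift_inj.
by rewrite lift_perm_id tpermD // eq_sym neq_lift.
Qed.

(** The increasing enumerations of the complements of i and of i+1 differ exactly by the
    transposition. *)
Lemma lift_perm_adj n (i j : 'I_n.+1) (s : 'S_n) : j = i.+1 :> nat ->
  (lift_perm ord0 i s * tperm i j = lift_perm ord0 j s)%g.
Proof.
move=> ij; apply/permP=> x; rewrite permM; case: (unliftP ord0 x) => [y|] ->; last first.
  by rewrite !lift_perm_id tpermL.
rewrite !lift_perm_lift; set z := s y; apply: val_inj.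
case: tpermP => [/(congr1 val)|/(congr1 val)|_ /eqP] /=; rewrite -?val_eqE /= /bump; lia.
Qed.

(** Adjacent transpositions generate S_n: induction on n covers the stabilizer of 0, and the image
    of 0 is then moved up one step at a time. *)
Lemma adj_perm_ind n (P : 'S_n -> Prop) : P 1%g ->
  (forall (s : 'S_n) (i j : 'I_n), j = i.+1 :> nat -> P s -> P (s * tperm i j)%g) ->
  forall s, P s.
Proof.
elim: n P => [|n IH] P P1 Pm s.
  by rewrite (_ : s = 1%g) //; apply/permP => -[].
rewrite -(perm_tailP s); move: (s ord0) (perm_tail s) => {s} k s.
have Pl (t : 'S_n) : P (lift_perm ord0 ord0 t).
  move: t; apply: IH => [|t i j ij Pt]; first by rewrite lift_perm1.
  rewrite -(lift_permM _ ord0) lift_perm_tperm; apply: Pm => //.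
  by rewrite !lift0 ij.
case: k => k; elim: k => [|k IHk] kn.
  by rewrite (_ : Ordinal kn = ord0) //; apply: val_inj.
by rewrite -(@lift_perm_adj _ (Ordinal (ltnW kn))) //; apply: Pm.
Qed.

End Perm.

Section Sites.
Variables (K : fieldType) (V : vectType K) (A : 'End(tensor V V)).
Hypotheses (AA : (A \o A = \1)%VF) (YB : yang_baxter A).
Local Notation Vn := (tensor_pow V).
Local Arguments op_at : simpl never.

Lemma op_at0 n : op_at A n.+2 0 = amp (Vn n) A.
Proof. by rewrite ampE. Qed.

Lemma op_atS n k : op_at A n.+1 k.+1 = tensor_map \1%VF (op_at A n k).
Proof. by []. Qed.

Lemma op_at_invol n k : (op_at A n k \o op_at A n k = \1)%VF.
Proof.
elim: n k => [|n IH] [|k]; try exact: comp_lfun1l; last first.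
  by rewrite op_atS tensor_map_comp comp_lfun1l IH tensor_map1.
case: n {IH} => [|n]; first exact: comp_lfun1l.
by rewrite op_at0 -amp_comp AA amp1.
Qed.

Lemma op_at_comm n k l : (k.+1 < l)%N ->
  (op_at A n k \o op_at A n l = op_at A n l \o op_at A n k)%VF.
Proof.
elim: n k l => [|n IH] k [|l] // kl.
case: k kl => [|k] kl; last by rewrite !op_atS !tensor_map_comp !comp_lfun1l IH.
case: n {IH} => [|n]; first exact: etrans (comp_lfun1l _) (esym (comp_lfun1r _)).
by case: l kl => // l _; rewrite op_at0 !op_atS amp_lft.
Qed.

Lemma op_at_braid n k : (k.+2 < n)%N ->
  (op_at A n k \o op_at A n k.+1 \o op_at A n k =
   op_at A n k.+1 \o op_at A n k \o op_at A n k.+1)%VF.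
Proof.
elim: n k => [|n IH] [|k] //.
  case: n {IH} => [|[|n]] // _; rewrite op_atS !op_at0; exact: yang_baxter_amp.
by rewrite ltnS => kn; rewrite !op_atS !tensor_map_comp !comp_lfun1l IH.
Qed.

(* The operator of the cycle taking site 0 to site k and the sites 1, ..., k
   one step down. *)
Fixpoint cyc n k : 'End(Vn n) := if k is l.+1 then (op_at A n l \o cyc n l)%VF else \1%VF.

(** The definition peels off the factor at the far end of the cycle; tracing out site 0 requires
    peeling off the one at site 0. *)
Lemma cycS n k : cyc n.+1 k.+1 = (tensor_map \1 (cyc n k) \o op_at A n.+1 0)%VF.
Proof.
elim: k => [|k IH]; first by rewrite /= tensor_map1 comp_lfun1l comp_lfun1r.
rewrite -[cyc n.+1 k.+2]/(op_at A n.+1 k.+1 \o cyc n.+1 k.+1)%VF IH op_atS.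
by rewrite comp_lfunA tensor_map_comp comp_lfun1l.
Qed.

Lemma op_cyc_gt n k i : (k < i)%N ->
  (op_at A n i \o cyc n k = cyc n k \o op_at A n i)%VF.
Proof.
elim: k => [|k IH] ki; first by rewrite comp_lfun1l comp_lfun1r.
by rewrite /= comp_lfunA -op_at_comm // -comp_lfunA IH ?comp_lfunA // ltnW.
Qed.

(** The braid relation enters the construction of the representation here, at k = i+2; longer cycles
    only add factors commuting with site i. *)
Lemma op_cyc_lt n k i : (i.+1 < k < n)%N ->
  (op_at A n i \o cyc n k = cyc n k \o op_at A n i.+1)%VF.
Proof.
elim: k => [|k IH] /andP[ik kn] //.
move: ik; rewrite ltnS leq_eqVlt => /orP[/eqP ik|ik]; last first.
  rewrite /= comp_lfunA op_at_comm // -comp_lfunA IH ?comp_lfunA //.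
  by rewrite ik ltnW.
rewrite -{k}ik in kn IH *.
rewrite /= !comp_lfunA op_at_braid // -!comp_lfunA; do 2 congr (_ \o _)%VF.
exact: op_cyc_gt.
Qed.

(* Every s in S_{n+1} is the cycle taking 0 to s(0) after a permutation of the
   sites 1, ..., n. *)
Fixpoint srep_rec n : 'S_n -> 'End(Vn n) :=
  if n is m.+1 then fun s : 'S_m.+1 =>
    (cyc m.+1 (s ord0) \o tensor_map \1 (srep_rec (perm_tail s)))%VF
  else fun _ => \1%VF.

Fact srep_key : unit. Proof. by []. Qed.
(* Locked, lest rewriting with [comp_lfunA] unfold it. *)
Definition srep n (s : 'S_n) : 'End(Vn n) := locked_with srep_key (srep_rec s).

Lemma srep_nil (s : 'S_0) : srep s = \1%VF.
Proof. by rewrite /srep unlock. Qed.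

Lemma srep_lift n (k : 'I_n.+1) (s : 'S_n) :
  srep (lift_perm ord0 k s) = (cyc n.+1 k \o tensor_map \1 (srep s))%VF.
Proof. by rewrite /srep !unlock /= perm_tail_lift lift_perm_id. Qed.

(** This replaces the Coxeter presentation of S_n. With k = s(0), the cycle grows if k = i and
    shrinks if k = j, since R^2 = 1; otherwise the transposition passes through the cycle and is
    absorbed by the tail. *)
Lemma srep_adj n (s : 'S_n) (i j : 'I_n) : j = i.+1 :> nat ->
  srep (s * tperm i j)%g = (op_at A n i \o srep s)%VF.
Proof.
elim: n s i j => [|n IH] s i j; first by case: i.
move=> ij; rewrite -(perm_tailP s); move: (s ord0) (perm_tail s) => {s} k s.
have [ki|ki] := eqVneq k i.
  by rewrite ki lift_perm_adj // !srep_lift ij comp_lfunA.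
have [kj|kj] := eqVneq k j.
  rewrite kj -{1}(lift_perm_adj s ij) -mulgA tperm2 mulg1 !srep_lift comp_lfunA.
  by rewrite ij /= comp_lfunA (op_at_invol n.+1 i) comp_lfun1l.
have [i' iE _] := unlift_some ki; have [j' jE _] := unlift_some kj.
have iV : i = bump k i' :> nat by rewrite iE.
have jV : j = bump k j' :> nat by rewrite jE.
have ki' : nat_of_ord k <> i by move/ord_inj => ki'; rewrite ki' eqxx in ki.
have kj' : nat_of_ord k <> j by move/ord_inj => kj'; rewrite kj' eqxx in kj.
have ij' : j' = i'.+1 :> nat.
  move: iV jV; rewrite /bump ij; lia.
rewrite {1}iE {1}jE -lift_perm_tperm lift_permM !srep_lift (IH _ _ _ ij').
have -> : tensor_map \1%VF (op_at A n i' \o srep s)%VF =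
    (op_at A n.+1 i'.+1 \o tensor_map \1 (srep s))%VF :> 'End(Vn n.+1).
  by rewrite op_atS tensor_map_comp comp_lfun1l.
rewrite !comp_lfunA; congr (_ \o _)%VF.
(* Below k the renumbering fixes the index and the cycle shifts it; above k the renumbering shifts
   it and the cycle commutes with the operator. *)
case: (ltnP i' k) => ik.
  have -> : (i : nat) = i' by rewrite iV /bump; lia.
  rewrite op_cyc_lt //; move: (ltn_ord k) jV; rewrite ij' /bump; lia.
have -> : (i : nat) = i'.+1 by rewrite iV /bump; lia.
by rewrite op_cyc_gt //.
Qed.

Lemma srep1 n : srep (1%g : 'S_n) = \1%VF.
Proof.
elim: n => [|n IH]; first exact: srep_nil.
rewrite -(lift_perm1 ord0) srep_lift IH tensor_map1.
by rewrite comp_lfun1l.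
Qed.

Lemma srep_tperm n (i j : 'I_n) : j = i.+1 :> nat ->
  srep (tperm i j) = op_at A n i.
Proof. by move=> ij; rewrite -[tperm i j]mul1g srep_adj // srep1 comp_lfun1r. Qed.

Lemma srepM n (t s : 'S_n) : srep (t * s)%g = (srep s \o srep t)%VF.
Proof.
move: s; apply: adj_perm_ind => [|s i j ij IH].
  by rewrite mulg1 srep1 comp_lfun1l.
by rewrite mulgA !srep_adj // IH comp_lfunA.
Qed.

Lemma srep_unique n (rho : 'S_n -> 'End(Vn n)) : rho 1%g = \1%VF ->
  (forall s t : 'S_n, rho (t * s)%g = (rho s \o rho t)%VF) ->
  (forall i j : 'I_n, j = i.+1 :> nat -> rho (tperm i j) = op_at A n i) ->
  forall s, rho s = srep s.
Proof.
move=> r1 rM rT; apply: adj_perm_ind => [|s i j ij IH]; first by rewrite srep1.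
by rewrite rM srep_adj // rT // IH.
Qed.

End Sites.

(** * Characters *)


Section FunCalculus.
Variables (K : fieldType) (V : vectType K) (d : nat).
Variables (u : 'I_d -> V) (u' : 'I_d -> 'Hom(V, K^o)) (t : 'I_d -> K).
Hypotheses (uP : is_frame u u') (uD : forall i j, u' i (u j) = (i == j)%:R).

Lemma frame_ext W (f g : 'Hom(V, W)) : (forall i, f (u i) = g (u i)) -> f = g.
Proof.
move=> fg; apply/lfunP=> v; rewrite -[v]uP !linear_sum; apply: eq_bigr => i _.
by rewrite !linearZ /= fg.
Qed.

(* f(T), for the operator T with eigenvectors u_i and eigenvalues t_i. *)
Definition fop (f : K -> K) : 'End(V) :=
  linfun (fun v => \sum_i (f (t i) * (u' i v : K)) *: u i).

Lemma fop_u f i : fop f (u i) = f (t i) *: u i.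
Proof.
rewrite linfunK => [|c x y].
  rewrite (bigD1 i) //= big1 => [|j ji]; rewrite uD.
    by rewrite eqxx mulr1 addr0.
  by rewrite (negPf ji) mulr0 scale0r.
rewrite scaler_sumr -big_split; apply: eq_bigr => j _ /=.
by rewrite linearP /= scalerA -scalerDl mulrDr mulrCA.
Qed.

Lemma fop_comp f g : (fop f \o fop g)%VF = fop (fun x => f x * g x).
Proof.
by apply: frame_ext => i; rewrite comp_lfunE !fop_u linearZ /= fop_u scalerA mulrC.
Qed.

Lemma fop1 : fop (fun=> 1) = \1%VF.
Proof. by apply: frame_ext => i; rewrite fop_u scale1r id_lfunE. Qed.

Lemma fop_eq f g : (forall i, f (t i) = g (t i)) -> fop f = fop g.
Proof. by move=> fg; apply: frame_ext => i; rewrite !fop_u fg. Qed.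

Lemma fopZ c f : fop (fun x => c * f x) = c *: fop f.
Proof. by apply: frame_ext => i; rewrite scale_lfunE !fop_u scalerA. Qed.

Lemma ltr_fop f : ltr (fop f) = \sum_i f (t i).
Proof.
rewrite (ltr_frame _ uP); apply: eq_bigr => i _.
by rewrite fop_u linearZ /= uD eqxx [LHS]mulr1.
Qed.

Variable T : 'End(V).
Hypothesis Tu : forall i, T (u i) = t i *: u i.

Lemma fop_id : fop id = T.
Proof. by apply: frame_ext => i; rewrite fop_u Tu. Qed.

(** Since u'_i T = t_i u'_i, the coordinate of [w] along u_i vanishes unless t_i = c. *)
Lemma fop_eigen f c w : T w = c *: w -> fop f w = f c *: w.
Proof.
have dualT i v : u' i (T v) = t i * (u' i v : K).
  rewrite -{1}[v]uP !linear_sum (bigD1 i) //= big1 => [|j ji]; rewrite !linearZ /= Tu linearZ /= uD.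
    by rewrite eqxx addr0 mulrC [_ *: 1]mulr1.
  by rewrite eq_sym (negPf ji) !scaler0.
move=> Tw; rewrite -[w]uP linear_sum scaler_sumr; apply: eq_bigr => i _.
rewrite linearZ /= fop_u !scalerA.
have : (t i - c) * (u' i w : K) = 0.
  by rewrite mulrBl -dualT Tw linearZ subrr.
move/eqP; rewrite mulf_eq0 subr_eq0 => /orP[/eqP->|/eqP->]; first by rewrite mulrC.
by rewrite mul0r mulr0.
Qed.

End FunCalculus.

Section Characters.
Variables (K : fieldType) (V : vectType K) (A : 'End(tensor V V)).
Hypotheses (AA : (A \o A = \1)%VF) (YB : yang_baxter A).
Hypothesis AT : (A \o tensor_map (ptr A) \1 = tensor_map \1 (ptr A) \o A)%VF.
Variables (d : nat) (u : 'I_d -> V) (u' : 'I_d -> 'Hom(V, K^o)) (t : 'I_d -> K).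
Hypotheses (uP : is_frame u u') (uD : forall i j, u' i (u j) = (i == j)%:R).
Hypothesis Tu : forall i, ptr A (u i) = t i *: u i.
Local Notation Vn := (tensor_pow V).
Local Notation fop := (fop u u' t).
Local Notation T := (ptr A).
Local Arguments op_at : simpl never.

(** By [AT], every slice A(u_i (x) w)(phi) is an eigenvector of T for t_i, on which f(T) is
    multiplication by f(t_i). *)
Lemma fop_intertwines f :
  (A \o tensor_map (fop f) \1 = tensor_map \1 (fop f) \o A)%VF.
Proof.
apply: tensor_ext => v w; rewrite !comp_lfunE.
rewrite -[v]uP pure_suml !linear_sum; apply: eq_bigr => i _ /=.
rewrite tensor_map_pure !linearZ /= (fop_u t uD) id_lfunE !pureZl !linearZ /=.
congr (_ *: _); apply/lfunP=> phi; rewrite scale_lfunE tensor_mapE comp_lfun1r.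
rewrite (fop_eigen uP uD Tu f (c := t i)) //.
have := congr1 (fun F : 'End(tensor V V) => F (pure (u i) w) phi) AT.
rewrite !comp_lfunE tensor_map_pure Tu id_lfunE tensor_mapE comp_lfun1r.
by rewrite pureZl linearZ scale_lfunE.
Qed.

Lemma fop_intertwinesr f :
  (A \o tensor_map \1 (fop f) = tensor_map (fop f) \1 \o A)%VF.
Proof.
transitivity ((A \o A) \o (tensor_map (fop f) \1 \o A))%VF.
  by rewrite -comp_lfunA (comp_lfunA A (tensor_map _ _)) fop_intertwines -comp_lfunA AA comp_lfun1r.
by rewrite AA comp_lfun1l.
Qed.

(* g_0(T) (x) ... (x) g_{n-1}(T) on V^{(x) n}. *)
Fixpoint Fop n : ('I_n -> K -> K) -> 'End(Vn n) :=
  if n is m.+1 then fun g : 'I_m.+1 -> K -> K =>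
    tensor_map (fop (g ord0)) (Fop (fun i => g (lift ord0 i)))
  else fun _ => \1%VF.

Lemma FopS n (g : 'I_n.+1 -> K -> K) :
  Fop g = tensor_map (fop (g ord0)) (Fop (fun i => g (lift ord0 i))).
Proof. by []. Qed.

Lemma Fop_eq n (g h : 'I_n -> K -> K) :
  (forall i j, g i (t j) = h i (t j)) -> Fop g = Fop h.
Proof.
elim: n g h => // n IH g h gh.
rewrite !FopS; congr tensor_map; first exact: (fop_eq uP uD).
by apply: IH => i j; apply: gh.
Qed.

Lemma Fop_comp n (g h : 'I_n -> K -> K) :
  (Fop g \o Fop h)%VF = Fop (fun i x => g i x * h i x).
Proof.
elim: n g h => [|n IH] g h; first exact: comp_lfun1l.
by rewrite !FopS tensor_map_comp (fop_comp _ uP uD) IH.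
Qed.

Lemma Fop1 n : Fop (fun (_ : 'I_n) _ => 1) = \1%VF.
Proof. by elim: n => // n IH; rewrite FopS IH (fop1 t uP uD) tensor_map1. Qed.

Lemma Fop_first n f :
  Fop (fun (i : 'I_n.+1) x => if i == ord0 then f x else 1) = tensor_map (fop f) \1%VF.
Proof. by rewrite FopS -(Fop1 n). Qed.

Lemma op_at_Fop n (i j : 'I_n) (g : 'I_n -> K -> K) : j = i.+1 :> nat ->
  (op_at A n i \o Fop g = Fop (fun k => g (tperm i j k)) \o op_at A n i)%VF.
Proof.
elim: n i j g => [|n IH] i j g ij; first by case: i ij.
case: (unliftP ord0 i) ij => [i'|] -> ij.
  case: (unliftP ord0 j) ij => [j'|] -> // ij; rewrite !lift0 in ij *.
  rewrite op_atS !FopS !tensor_map_comp comp_lfun1l comp_lfun1r tpermD //.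
  rewrite (IH i' j') //; last by case: ij.
  congr (tensor_map _ (_ \o _)%VF); apply: Fop_eq => k l.
  by rewrite inj_tperm //; apply: lift_inj.
case: n {IH} i j g ij => [|n] i j g ij; first by case: j ij => -[].
have -> : j = lift ord0 ord0 by apply: ord_inj; rewrite ij.
rewrite !FopS op_at0 tpermL (_ : tperm _ _ (lift ord0 ord0) = ord0) ?tpermR //.
set F := Fop (fun k => g (lift ord0 (lift ord0 k))).
have -> : Fop (fun k => g (tperm ord0 (lift ord0 ord0) (lift ord0 (lift ord0 k)))) = F.
  by apply: Fop_eq => k l; rewrite tpermD.
have E f h : tensor_map (fop f) (tensor_map (fop h) F) =
    (amp (Vn n) (tensor_map (fop f) (fop h)) \o tensor_map \1 (tensor_map \1 F))%VF.
  by rewrite amp_map !tensor_map_comp !comp_lfun1l !comp_lfun1r.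
rewrite !E !comp_lfunA -[in RHS]comp_lfunA -amp_lft [in RHS]comp_lfunA -!amp_comp.
congr (amp _ _ \o _)%VF.
have E2 f h : tensor_map (fop f) (fop h) = (tensor_map (fop f) \1 \o tensor_map \1 (fop h))%VF.
  by rewrite tensor_map_comp comp_lfun1l comp_lfun1r.
rewrite E2 comp_lfunA fop_intertwines -comp_lfunA fop_intertwinesr comp_lfunA.
by rewrite tensor_map_comp comp_lfun1l comp_lfun1r.
Qed.

Lemma srep_Fop n (s : 'S_n) (g : 'I_n -> K -> K) :
  (srep A s \o Fop (fun i => g (s i)) = Fop g \o srep A s)%VF.
Proof.
move: s g; apply: adj_perm_ind => [|s i j ij IH] g.
  rewrite srep1 comp_lfun1l comp_lfun1r; apply: Fop_eq => i j; by rewrite perm1.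
rewrite (srep_adj AA YB) // -comp_lfunA.
have -> : Fop (fun k => g ((s * tperm i j)%g k)) = Fop (fun k => (fun l => g (tperm i j l)) (s k)).
  by apply: Fop_eq => k l; rewrite permM.
rewrite (IH (fun l => g (tperm i j l))) comp_lfunA (op_at_Fop _ ij) -comp_lfunA.
by congr (_ \o _)%VF; apply: Fop_eq => k l; rewrite tpermK.
Qed.

Lemma ltr_srep0 n (s : 'S_n) (g : 'I_n.+1 -> K -> K) :
  ltr (srep A (lift_perm ord0 ord0 s) \o Fop g)%VF =
  (\sum_i g ord0 (t i)) * ltr (srep A s \o Fop (fun i => g (lift ord0 i)))%VF.
Proof.
rewrite srep_lift comp_lfun1l FopS tensor_map_comp comp_lfun1l ltr_map.
by rewrite (ltr_fop t uP uD).
Qed.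

(* Tracing out site 0 joins the two ends of its cycle, leaving behind one more
   factor T. *)
Lemma ltr_srepS n (k : 'I_n.+1) (s : 'S_n.+1) (g : 'I_n.+2 -> K -> K) :
  ltr (srep A (lift_perm ord0 (lift ord0 k) s) \o Fop g)%VF =
  ltr (srep A (s * lift_perm ord0 k 1)%g \o
    Fop (fun i x => (if s i == ord0 then x * g ord0 x else 1) * g (lift ord0 i) x))%VF.
Proof.
have -> : srep A (s * lift_perm ord0 k 1)%g = (cyc A n.+1 k \o srep A s)%VF.
  by rewrite srepM // srep_lift srep1 tensor_map1 comp_lfun1r.
rewrite srep_lift lift0 cycS FopS op_at0; set C := cyc A n.+1 k; set S := srep A s.
set F := Fop (fun i => g (lift ord0 i)).
have -> : tensor_map (fop (g ord0)) F = (tensor_map (fop (g ord0)) \1 \o tensor_map \1 F)%VF.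
  by rewrite tensor_map_comp comp_lfun1l comp_lfun1r.
rewrite -!comp_lfunA (comp_lfunA (tensor_map \1 S)).
rewrite tensor_map_comp comp_lfun1l comp_lfun1r.
have -> : tensor_map (fop (g ord0)) S =
    (tensor_map (fop (g ord0)) \1 \o tensor_map \1 S)%VF.
  by rewrite tensor_map_comp comp_lfun1l comp_lfun1r.
(* Only the leading A and g_0(T) touch site 0. The other factors leave the partial trace, and what
   remains inside becomes g_0(T) T. *)
rewrite -ltr_ptr ptr_compl !comp_lfunA !ptr_compr.
rewrite -tensor_map1 -amp_map -amp_comp ptr_amp fop_intertwines ptr_compl.
rewrite -(fop_id uP uD Tu) (fop_comp _ uP uD) -Fop_first.
rewrite -!comp_lfunA; congr (ltr (_ \o _)%VF).
(* Passing through s moves this factor from site 0 to the site i with s(i) = 0. *)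
rewrite comp_lfunA; etransitivity.
  apply: (congr1 (fun Z : 'End(Vn n.+1) => (Z \o F)%VF)); exact: esym (srep_Fop s _).
rewrite -comp_lfunA Fop_comp; apply: congr1; apply: (@Fop_eq n.+1) => i j.
by case: ifP => // _; rewrite [g ord0 _ * _]mulrC.
Qed.

(** The inserted [g] carries the induction: tracing out site 0 shortens the cycle and replaces g(x)
    by g(x) x. *)
Lemma ltr_cyc n (g : K -> K) :
  ltr (cyc A n.+1 n \o tensor_map (fop g) \1)%VF = \sum_i g (t i) * t i ^+ n.
Proof.
elim: n g => [|n IH] g.
  rewrite comp_lfun1l ltr_map (ltr_fop t uP uD) ltr_regular id_lfunE mulr1.
  by apply: eq_bigr => i _; rewrite mulr1.
rewrite cycS -comp_lfunA op_at0 -ltr_ptr ptr_compl -tensor_map1 -amp_map -amp_comp.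
rewrite ptr_amp fop_intertwines ptr_compl -(fop_id uP uD Tu) (fop_comp _ uP uD) IH.
by apply: eq_bigr => i _; rewrite exprS mulrA.
Qed.

End Characters.


Section CharacterEq.
Variables (K : fieldType) (V W : vectType K).
Variables (A : 'End(tensor V V)) (B : 'End(tensor W W)).
Hypotheses (AA : (A \o A = \1)%VF) (YBA : yang_baxter A).
Hypotheses (BB : (B \o B = \1)%VF) (YBB : yang_baxter B).
Hypothesis AT : (A \o tensor_map (ptr A) \1 = tensor_map \1 (ptr A) \o A)%VF.
Hypothesis BT : (B \o tensor_map (ptr B) \1 = tensor_map \1 (ptr B) \o B)%VF.
Variables (d d2 : nat) (u : 'I_d -> V) (u' : 'I_d -> 'Hom(V, K^o)) (t : 'I_d -> K).
Variables (w : 'I_d2 -> W) (w' : 'I_d2 -> 'Hom(W, K^o)) (r : 'I_d2 -> K).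
Hypotheses (uP : is_frame u u') (uD : forall i j, u' i (u j) = (i == j)%:R).
Hypotheses (wP : is_frame w w') (wD : forall i j, w' i (w j) = (i == j)%:R).
Hypothesis Tu : forall i, ptr A (u i) = t i *: u i.
Hypothesis Tw : forall i, ptr B (w i) = r i *: w i.
Hypothesis tr : forall f : K -> K, \sum_i f (t i) = \sum_i f (r i).

(** Both sides obey the recursion of [ltr_srep0] and [ltr_srepS], which sees A and B only through
    sums over their spectra. *)
Lemma ltr_srep_Fop_eq n (s : 'S_n) (g : 'I_n -> K -> K) :
  ltr (srep A s \o Fop u u' t g)%VF = ltr (srep B s \o Fop w w' r g)%VF.
Proof.
elim: n s g => [|n IH] s g; first by rewrite !srep_nil !comp_lfun1l !ltr_regular !id_lfunE.
rewrite -(perm_tailP s); move: (s ord0) (perm_tail s) => {s} k s.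
case: (unliftP ord0 k) => [k'|] ->.
  case: n IH s k' {k} g => [|n] IH s k' g; first by case: k'.
  by rewrite (ltr_srepS AA YBA AT uP uD Tu) (ltr_srepS BB YBB BT wP wD Tw) IH.
by rewrite (ltr_srep0 _ _ uP uD) (ltr_srep0 _ _ wP wD) IH tr.
Qed.

Lemma ltr_srep_eq n (s : 'S_n) : ltr (srep A s) = ltr (srep B s).
Proof.
have := ltr_srep_Fop_eq s (fun _ _ => 1).
by rewrite (Fop1 t uP uD) (Fop1 r wP wD) !comp_lfun1r.
Qed.

End CharacterEq.

(** * Symmetrizers on an eigenspace *)

Lemma big_perm_lift (R : Type) (idx : R) (op : Monoid.com_law idx) n (F : 'S_n.+1 -> R) :
  \big[op/idx]_s F s = \big[op/idx]_k \big[op/idx]_s F (lift_perm ord0 k s).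
Proof.
rewrite pair_big (reindex (fun p : 'I_n.+1 * 'S_n => lift_perm ord0 p.1 p.2)) //=.
exists (fun s : 'S_n.+1 => (s ord0, perm_tail s)) => [[k s] _ | s _] /=.
  by rewrite lift_perm_id perm_tail_lift.
exact: perm_tailP.
Qed.

Section Symmetrizer.
Variables (K : numFieldType) (V : vectType K) (A : 'End(tensor V V)).
Hypotheses (AA : (A \o A = \1)%VF) (YB : yang_baxter A).
Hypothesis AT : (A \o tensor_map (ptr A) \1 = tensor_map \1 (ptr A) \o A)%VF.
Variables (d : nat) (u : 'I_d -> V) (u' : 'I_d -> 'Hom(V, K^o)) (t : 'I_d -> K).
Hypotheses (uP : is_frame u u') (uD : forall i j, u' i (u j) = (i == j)%:R).
Hypothesis Tu : forall i, ptr A (u i) = t i *: u i.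
Variables (c e : K).
Hypothesis e2 : e * e = 1.

Let ind (x : K) : K := (x == c)%:R.
Local Notation Fop := (Fop u u' t).
Local Notation P n := (Fop (fun (_ : 'I_n) => ind)).
Local Notation D := (\sum_i ind (t i)).
Let sgn n (s : 'S_n) : K := e ^+ s.

Lemma expr_xor (a b : bool) : e ^+ (a (+) b) = e ^+ a * e ^+ b.
Proof. by case: a b => [] []; rewrite /= ?expr0 ?expr1 ?e2 ?mulr1 ?mul1r. Qed.

Lemma sgnM n (s r : 'S_n) : sgn (s * r)%g = sgn s * sgn r.
Proof. by rewrite /sgn odd_permM expr_xor. Qed.

Lemma FopZ n (b : 'I_n -> K) (g : 'I_n -> K -> K) :
  Fop (fun i x => b i * g i x) = (\prod_i b i) *: Fop g.
Proof.
elim: n b g => [|n IH] b g; first by rewrite big_ord0 scale1r.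
rewrite !FopS IH (fopZ t uP uD) big_ord_recl tensor_mapZr tensor_mapZl.
by rewrite scalerA mulrC.
Qed.

(* n! times the symmetrizer (e = 1) or antisymmetrizer (e = -1), cut down to the
   n-th tensor power of the eigenspace for c. *)
Definition qsym n := \sum_(s : 'S_n) sgn s *: (srep A s \o P n)%VF.

Lemma srep_P n (s : 'S_n) : (srep A s \o P n = P n \o srep A s)%VF.
Proof. by rewrite -(srep_Fop AA YB AT uP uD Tu). Qed.

Lemma P_idem n : (P n \o P n = P n)%VF.
Proof.
rewrite (Fop_comp _ uP uD); apply: (Fop_eq uP uD) => i j.
by rewrite /ind -natrM mulnb andbb.
Qed.

Lemma qsym_comp n : (qsym n \o qsym n = n`!%:R *: qsym n)%VF.
Proof.
rewrite {1}/qsym comp_lfun_suml.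
rewrite (eq_bigr (fun=> qsym n)); last first.
  move=> s _; rewrite comp_lfun_sumr /qsym.
  rewrite [RHS](reindex_inj (mulIg s)); apply: eq_bigr => r _ /=.
  rewrite -comp_lfunZl -comp_lfunZr scalerA sgnM srepM // [sgn s * _]mulrC.
  by rewrite !comp_lfunA -[(_ \o P n \o _)%VF]comp_lfunA -srep_P !comp_lfunA
     -[(_ \o P n \o P n)%VF]comp_lfunA P_idem.
by rewrite sumr_const card_Sn scaler_nat.
Qed.

(** Divided by n! it is idempotent, so its trace is a rank. *)
Lemma qsym_nat n : exists m : nat, ltr (qsym n) = (m * n`!)%:R.
Proof.
have n0 : n`!%:R != 0 :> K by rewrite pnatr_eq0 -lt0n fact_gt0.
have [m mE] : exists m : nat, ltr (n`!%:R^-1 *: qsym n) = m%:R.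
  apply: ltr_idem; rewrite -comp_lfunZl -comp_lfunZr qsym_comp !scalerA.
  by rewrite -mulrA mulVf // mulr1.
exists m; rewrite natrM -mE linearZ /= mulrAC mulVf // mul1r //.
Qed.

(** Split the sum by s(0). If s fixes 0, the traced-out site contributes D. Each of the n other
    values leaves a factor T, equal to c on the eigenspace, and a permutation of opposite parity,
    hence a factor e. *)
Lemma ltr_qsym n : ltr (qsym n) = \prod_(k < n) (D + k%:R * e * c).
Proof.
have qE m : ltr (qsym m) = \sum_(s : 'S_m) sgn s * ltr (srep A s \o P m)%VF.
  by rewrite linear_sum; apply: eq_bigr => s _; rewrite linearZ.
elim: n => [|n IH].
  rewrite big_ord0 qE (big_pred1 1%g) => [|s]; last first.
    by apply/esym/eqP/permP => -[].
  by rewrite /sgn odd_perm1 mul1r srep_nil comp_lfun1l ltr_regular id_lfunE.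
rewrite big_ord_recr [X in _ = X * _]/= -IH qE big_perm_lift big_ord_recl [RHS]mulrC mulrDl.
congr (_ + _).
  rewrite qE mulr_sumr; apply: eq_bigr => s _.
  rewrite (ltr_srep0 _ _ uP uD) /sgn odd_lift_perm /= mulrCA //.
case: n {IH} => [|n]; first by rewrite big_ord0 !mul0r.
rewrite (eq_bigr (fun=> e * c * ltr (qsym n.+1))); last first.
  move=> k _; rewrite qE [in RHS](reindex_inj (mulIg (lift_perm ord0 k 1%g))) mulr_sumr.
  apply: eq_bigr => s _; rewrite sgnM.
  set L := ltr (srep A (s * lift_perm ord0 k 1)%g \o P n.+1)%VF.
  have -> : ltr (srep A (lift_perm ord0 (lift ord0 k) s) \o P n.+2)%VF = c * L.
    rewrite (ltr_srepS AA YB AT uP uD Tu).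
    have -> : Fop (fun i x => (if s i == ord0 then x * ind x else 1) * ind x) = c *: P n.+1.
      transitivity (Fop (fun i x => (if s i == ord0 then c else 1) * ind x)).
        apply: (Fop_eq uP uD) => i j; case: ifP => // _.
        by rewrite /ind; case: eqP => [->|_]; rewrite ?mulr1 ?mulr0.
      rewrite FopZ; congr (_ *: _); rewrite (bigD1 ((s^-1)%g ord0)) //= permKV eqxx.
      rewrite big1 ?mulr1 // => i; case: (s i =P ord0) => // <-.
      by rewrite permK eqxx.
    by rewrite -comp_lfunZr linearZ.
  move: L => L; rewrite /sgn !odd_lift_perm odd_perm1 lift0 oddS.
  move: (odd k) (odd_perm s) => a b; rewrite -[odd ord0]/false !addbF !addFb.
  by case: a b => [] []; rewrite ?expr0 ?expr1 /=; ring: e2.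
by rewrite sumr_const card_ord -[LHS]mulr_natl !mulrA.
Qed.

End Symmetrizer.

(** * Eigenvalues of the partial trace *)


Section EigenRational.
Variable K : numFieldType.
Variables (d : nat) (c : K).
Hypothesis d_gt0 : (0 < d)%N.
Hypothesis H : forall e : K, e * e = 1 -> forall n,
  exists m : nat, \prod_(k < n) (d%:R + k%:R * e * c) = (m * n`!)%:R.

(* If the factor k vanishes, the product for n = k is (d / k)^k k!. *)
Lemma eigen_vanish (e : K) k : e * e = 1 -> (0 < k)%N -> d%:R + k%:R * e * c = 0 ->
  exists a : nat, [/\ (0 < a)%N, (a %| d)%N & e * c = - a%:R].
Proof.
move=> e2 k0 dk; have k0' : k%:R != 0 :> K by rewrite pnatr_eq0 -lt0n.
have ec : e * c = - (d%:R / k%:R).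
  apply: (mulfI k0'); rewrite mulrA -[_ * c](addKr d%:R) dk addr0.
  by rewrite mulrN mulrC divfK.
have [m mE] := H e2 k; move: mE.
rewrite (eq_bigr (fun j : 'I_k => d%:R / k%:R * (k - j)%:R)); last first.
  move=> j _; rewrite -mulrA ec natrB; last exact: ltnW.
  by rewrite mulrBr divfK // mulrN [j%:R * _]mulrC.
rewrite big_split /= prodr_const card_ord -natr_prod -ffact_prod ffactnn natrM.
have f0 : k`!%:R != 0 :> K by rewrite pnatr_eq0 -lt0n fact_gt0.
move/(mulIf f0); rewrite expr_div_n => /(canRL (divfK (expf_neq0 k k0'))).
rewrite -!natrX -natrM => /eqP; rewrite eqr_nat => /eqP dkE.
have kd : (k %| d)%N by rewrite -(dvdn_pexp2r k d k0) dkE dvdn_mull.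
exists (d %/ k)%N; split; first by rewrite divn_gt0 // dvdn_leq.
  by apply/dvdnP; exists k; rewrite mulnC divnK.
rewrite ec; congr (- _); rewrite -{1}(divnK kd) natrM mulfK //.
Qed.

(** If no factor vanishes for either sign, the products are nonzero natural numbers, hence positive,
    and so is each factor as a quotient of consecutive products. *)
Lemma eigen_rational :
  exists a : nat, [/\ (0 < a)%N, (a %| d)%N & c = a%:R \/ c = - a%:R].
Proof.
have d0 : d%:R != 0 :> K by rewrite pnatr_eq0 -lt0n.
have [[e [k [e2 k0 /(eigen_vanish e2 k0) [a [a0 ad ac]]]]] | nz] := EM
  (exists e k, [/\ e * e = 1 :> K, (0 < k)%N & d%:R + k%:R * e * c = 0]).
  exists a; split=> //; have cE : c = e * - a%:R by rewrite -ac mulrA e2 mul1r.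
  have /eqP := e2; rewrite -expr2 sqrf_eq1 => /orP[]/eqP eE; rewrite cE eE.
    by right; rewrite mul1r.
  by left; rewrite mulN1r opprK.
have fac_neq0 e k : e * e = 1 -> d%:R + k%:R * e * c != 0.
  move=> e2; case: k => [|k]; first by rewrite !mul0r addr0.
  by apply/eqP=> dk; apply: nz; exists e, k.+1.
have prod_gt0 e n : e * e = 1 -> 0 < \prod_(k < n) (d%:R + k%:R * e * c).
  move=> e2; have [m mE] := H e2 n; have: (m * n`!)%:R != 0 :> K.
    by rewrite -mE; apply/prodf_neq0 => k _; apply: fac_neq0.
  by rewrite mE pnatr_eq0 ltr0n lt0n.
have fac_gt0 e n : e * e = 1 -> 0 < d%:R + n%:R * e * c.
  move=> e2; have := prod_gt0 e n.+1 e2; rewrite big_ord_recr /=.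
  by rewrite pmulr_rgt0 // prod_gt0.
(* The case n = 2 reads d (d + c) = 2 m, so d c is an integer. *)
have [m mE] := H (mulr1 1) 2.
pose z : int := (m * 2)%:Z - (d * d)%:Z.
have zE : z%:~R = d%:R * c.
  move: mE; rewrite !big_ord_recr big_ord0 /= mul1r !mul0r addr0 !mul1r => mE.
  rewrite /z rmorphB /= -!pmulrn -mE natrM; ring.
(* d + n c and d - n c are now positive for all n, while d c is an integer: so
   c = 0, and n! divides d^n for all n. *)
have z_pos (e : K) : e * e = 1 -> 0 < (d * d)%:R + (d * d)%:R * e * z%:~R.
  move=> e2; have d0' : 0 < d%:R :> K by rewrite ltr0n.
  (* At n = d^2, multiplying the factor by d gives d^2 (1 + e z); both signs together leave only z =
     0. *)
  have := fac_gt0 e (d * d)%N e2; rewrite -(pmulr_rgt0 _ d0') zE natrM => h.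
  by move: h; rewrite mulrDr; congr (0 < _ + _); ring.
have z0 : z = 0.
  have dd0 : 0 < (d * d)%:R :> K by rewrite ltr0n muln_gt0 d_gt0.
  have h1 : 0 < 1 + z.
    have := z_pos 1 (mulr1 1).
    rewrite mulr1 -[X in X + _]mulr1 -mulrDr (pmulr_rgt0 _ dd0).
    by rewrite -[1 in X in X -> _]/(1%:~R) -intrD ltr0z.
  have h2 : 0 < 1 - z.
    have := z_pos (-1) (etrans (mulrNN 1 1) (mulr1 1)).
    rewrite mulrN1 mulNr -[X in X - _]mulr1 -mulrBr (pmulr_rgt0 _ dd0).
    by rewrite -[1 in X in X -> _]/(1%:~R) -intrB ltr0z.
  by move: (z) h1 h2 => y; lia.
have c0 : c = 0 by apply: (mulfI d0); rewrite -zE z0 mulr0.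
(* A prime p > d divides p! but not d^p. *)
have [p dp pp] := prime_above d; have [q qE] := H (mulr1 1) p.
have /eqP : (d ^ p)%:R = (q * p`!)%:R :> K.
  rewrite -qE (eq_bigr (fun=> d%:R)) => [|k _]; last by rewrite c0 mulr0 addr0.
  by rewrite prodr_const card_ord natrX.
rewrite eqr_nat => /eqP dpE.
have : (p %| d ^ p)%N by rewrite dpE dvdn_mull // dvdn_fact // leqnn prime_gt0.
by rewrite Euclid_dvdX // => /andP[/(dvdn_leq d_gt0)]; rewrite leqNgt dp.
Qed.
End EigenRational.

(** * Representations with equal characters *)


Lemma mxtrace_lin_mx (F : fieldType) m n (f : {linear 'M[F]_(m, n) -> 'M[F]_(m, n)}) :
  \tr (lin_mx f) = \sum_i \sum_j f (delta_mx i j) i j.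
Proof.
rewrite pair_big /mxtrace (reindex _ (curry_mxvec_bij m n)) /=.
apply: eq_bigr => -[i j] _ /=; rewrite !mxE /=.
by rewrite -mxvec_delta mxvecK mxvecE.
Qed.

Section RepSim.
Variables (F : numFieldType) (gT : finGroupType) (m n : nat).
Variables (r1 : gT -> 'M[F]_m) (r2 : gT -> 'M[F]_n).
Hypotheses (r11 : r1 1%g = 1%:M) (r21 : r2 1%g = 1%:M).
Hypotheses (r1M : forall x y, r1 (x * y)%g = r1 x *m r1 y).
Hypotheses (r2M : forall x y, r2 (x * y)%g = r2 x *m r2 y).
Hypothesis chi : forall x, \tr (r1 x) = \tr (r2 x).

Let N : F := #|gT|%:R.
Let N0 : N != 0.
Proof. by rewrite pnatr_eq0 -lt0n; apply/card_gt0P; exists 1%g. Qed.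

Definition intertwiner (X : 'M[F]_(m, n)) := forall x, r1 x *m X = X *m r2 x.

Lemma rep1V x : r1 x *m r1 x^-1 = 1%:M. Proof. by rewrite -r1M mulgV r11. Qed.
Lemma rep2V x : r2 x *m r2 x^-1 = 1%:M. Proof. by rewrite -r2M mulgV r21. Qed.

Definition avg (M : 'M[F]_(m, n)) := \sum_x r1 x *m M *m r2 x^-1.

Lemma avg_intertwiner M : intertwiner (avg M).
Proof.
move=> y; rewrite mulmx_sumr mulmx_suml (reindex_inj (mulgI y^-1)%g) /=.
apply: eq_bigr => x _; rewrite !mulmxA -r1M mulKVg.
by rewrite invMg invgK r2M !mulmxA.
Qed.

(* The average of a pseudo-inverse of an intertwiner is again one. *)
Lemma pinv_intertwiner X : intertwiner X ->
  exists Y : 'M[F]_(n, m), (forall x, r2 x *m Y = Y *m r1 x) /\ X *m Y *m X = X.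
Proof.
move=> Xi; have [P XPX] : exists P : 'M_(n, m), X *m P *m X = X.
  by exists (pinvmx X); rewrite mulmxKpV.
exists (N^-1 *: \sum_x r2 x *m P *m r1 x^-1); split=> [y|].
  rewrite -scalemxAr -scalemxAl; congr (_ *: _).
  rewrite mulmx_sumr mulmx_suml (reindex_inj (mulgI y^-1)%g) /=.
  apply: eq_bigr => x _; rewrite !mulmxA -r2M mulKVg.
  by rewrite invMg invgK r1M !mulmxA.
rewrite -scalemxAr -scalemxAl mulmx_sumr mulmx_suml (eq_bigr (fun=> X)) => [|x _].
  by rewrite sumr_const -[X *+ _]scaler_nat scalerA mulVf ?scale1r.
have XV : r1 x^-1 *m X = X *m r2 x^-1 by apply: Xi.
rewrite -!mulmxA XV !mulmxA -Xi -(mulmxA (r1 x) X) -(mulmxA (r1 x) _ X).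
by rewrite XPX Xi -mulmxA rep2V mulmx1.
Qed.

(* The sum is #|G| times the trace of the projection of M_m(F) onto the
   intertwiners of the subrepresentation cut out by e. *)
Lemma char_norm_neq0 (e : 'M[F]_m) : e != 0 -> e *m e = e ->
  (forall x, r1 x *m e = e *m r1 x) ->
  \sum_x \tr (r1 x *m e) * \tr (r1 x^-1 *m e) != 0.
Proof.
move=> e0 ee er.
pose f (M : 'M[F]_m) := N^-1 *: \sum_x (r1 x *m e) *m M *m (r1 x^-1 *m e).
have f_lin : linear f.
  move=> a X Y; rewrite /f scalerA [a * _]mulrC -scalerA -scalerDr; congr (_ *: _).
  rewrite scaler_sumr -big_split; apply: eq_bigr => x _ /=.
  by rewrite mulmxDr mulmxDl -scalemxAr -scalemxAl.
pose fl : {linear 'M[F]_m -> 'M[F]_m} :=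
  HB.pack f (GRing.isLinear.Build _ _ _ _ f f_lin).
have trf : \tr (lin_mx fl) = N^-1 * \sum_x \tr (r1 x *m e) * \tr (r1 x^-1 *m e).
  have E (A B : 'M[F]_m) i j : (A *m delta_mx i j *m B) i j = A i i * B j j.
    rewrite -mulmxA mxE (bigD1 i) //= big1 => [|k ki]; rewrite mxE.
      by rewrite (bigD1 j) //= big1 ?addr0 => [|l lj];
        rewrite mxE ?eqxx ?mul1r // (negPf lj) andbF mul0r.
    by rewrite big1 ?mulr0 // => l _; rewrite mxE (negPf ki) mul0r.
  rewrite mxtrace_lin_mx mulr_sumr.
  transitivity (\sum_i \sum_j \sum_x N^-1 * ((r1 x *m e) i i * (r1 x^-1 *m e) j j)).
    apply: eq_bigr => i _; apply: eq_bigr => j _; rewrite /= /f mxE summxE mulr_sumr.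
    by apply: eq_bigr => x _; rewrite E.
  under eq_bigr => i _ do rewrite exchange_big.
  rewrite exchange_big; apply: eq_bigr => x _ /=; rewrite /mxtrace.
  rewrite mulr_suml mulr_sumr; apply: eq_bigr => i _.
  by rewrite !mulr_sumr.
have eRe x p (W : 'M_(m, p)) : e *m (r1 x *m (e *m W)) = r1 x *m (e *m W).
  by rewrite mulmxA -er -mulmxA (mulmxA e) ee.
have f_conj y M : (r1 y *m e) *m f M *m (r1 y^-1 *m e) = f M.
  rewrite /f -scalemxAr -scalemxAl; congr (_ *: _); rewrite mulmx_sumr mulmx_suml.
  rewrite [RHS](reindex_inj (mulgI y)); apply: eq_bigr => x _.
  rewrite invMg !r1M -!mulmxA eRe; do 4 congr (_ *m _).
  by have := eRe y^-1%g _ 1%:M; rewrite mulmx1 => ->.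
have ff M : f (f M) = f M.
  rewrite {1}/f (eq_bigr (fun=> f M)) => [|x _]; last exact: f_conj.
  by rewrite sumr_const -[_ *+ _]scaler_nat scalerA mulVf ?scale1r.
have fe : f e = e.
  rewrite /f (eq_bigr (fun=> e)) => [|x _].
    by rewrite sumr_const -[_ *+ _]scaler_nat scalerA mulVf ?scale1r.
  by rewrite -!mulmxA (mulmxA e e) ee (mulmxA e (r1 _)) -er -mulmxA ee mulmxA rep1V mul1mx.
(* In characteristic zero an idempotent of trace 0 is 0, yet [f] fixes [e]. *)
apply/negP=> /eqP S0; move: trf; rewrite S0 mulr0 mxtrace_idem => [/eqP|].
  rewrite pnatr_eq0 mxrank_eq0 => /eqP f0; case/negP: e0.
  by rewrite -(inj_eq (can_inj mxvecK)) linear0 -[e]fe -[f e]/(fl e) -mul_vec_lin f0 mulmx0.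
apply/row_matrixP => k; rewrite !rowE mulmxA -[delta_mx 0 k]vec_mxK.
by rewrite !mul_vec_lin /= ff.
Qed.

(* The kernel and cokernel of X have the same character, hence a nonzero
   intertwiner between them, which is added to X. *)
Lemma mxrank_intertwiner_lt X : intertwiner X -> ~~ (row_free X && row_full X) ->
  exists2 X', intertwiner X' & (\rank X < \rank X')%N.
Proof.
move=> Xi Xn; have [Y [Yi XYX]] := pinv_intertwiner Xi.
(* Acting on rows, [e] projects onto the kernel of X and [e'] onto a complement of its image. *)
pose e := 1%:M - X *m Y; pose e' := 1%:M - Y *m X.
have eX : e *m X = 0 by rewrite mulmxBl mul1mx XYX subrr.
have Xe' : X *m e' = 0 by rewrite mulmxBr mulmx1 mulmxA XYX subrr.
have ee : e *m e = e by rewrite {2}/e mulmxBr mulmx1 mulmxA eX mul0mx subr0.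
have e'e' : e' *m e' = e' by rewrite {1}/e' mulmxBl mul1mx -mulmxA Xe' mulmx0 subr0.
have er x : r1 x *m e = e *m r1 x.
  by rewrite mulmxBl mulmxBr mul1mx mulmx1 mulmxA Xi -!mulmxA Yi.
have e'r x : r2 x *m e' = e' *m r2 x.
  by rewrite mulmxBl mulmxBr mul1mx mulmx1 mulmxA Yi -!mulmxA Xi.
have psi x : \tr (r1 x *m e) = \tr (r2 x *m e').
  rewrite !mulmxBr !mulmx1 !linearB /= chi; congr (_ - _).
  by rewrite mulmxA Xi -mulmxA mxtrace_mulC -mulmxA.
have e0 : e != 0.
  apply: contra Xn => /eqP e0.
  have e'0 : e' = 0.
    have := psi 1%g; rewrite r11 r21 !mul1mx e0 linear0 mxtrace_idem // => /esym/eqP.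
    by rewrite pnatr_eq0 mxrank_eq0 => /eqP.
  apply/andP; split.
    by apply/row_freeP; exists Y; apply/esym/eqP; rewrite -subr_eq0 -/e e0.
  by apply/row_fullP; exists Y; apply/esym/eqP; rewrite -subr_eq0 -/e' e'0.
(* If all averages vanished, taking M = [delta_mx j k] would kill every sum of products of matrix
   entries, and with them the character norm of the kernel. *)
have [M MP] : exists M, avg (e *m M *m e') != 0.
  apply: contrapT => nM; case/negP: (char_norm_neq0 e0 ee er); apply/eqP.
  have E i j k l : \sum_x (r1 x *m e) i j * (e' *m r2 x^-1) k l = 0.
    have : avg (e *m delta_mx j k *m e') = 0.
      by apply: contrapT => /eqP h; apply: nM; exists (delta_mx j k).
    move/matrixP/(_ i l); rewrite [RHS]mxE summxE => h; apply: etrans h; apply: eq_bigr => x _.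
    rewrite !mulmxA -mulmxA [RHS]mxE (bigD1 k) //= big1 => [|a ak].
      rewrite addr0; congr (_ * _).
      by rewrite [RHS]mxE (bigD1 j) //= big1 => [|b bj];
        rewrite ?addr0 [delta_mx _ _ _ _]mxE ?eqxx ?mulr1 // (negPf bj) mulr0.
    by rewrite [X in X * _]mxE big1 ?mul0r // => b _;
      rewrite [delta_mx _ _ _ _]mxE (negPf ak) andbF mulr0.
  transitivity (\sum_x \sum_i \sum_k (r1 x *m e) i i * (e' *m r2 x^-1) k k).
    apply: eq_bigr => x _; rewrite (psi x^-1%g) [\tr (r2 _ *m _)]mxtrace_mulC mulr_suml.
    by apply: eq_bigr => i _; rewrite mulr_sumr.
  rewrite exchange_big big1 // => i _; rewrite exchange_big big1 // => k _; exact: E.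
pose Z := avg (e *m M *m e').
have Zi : intertwiner Z by exact: avg_intertwiner.
have eZ : e *m Z = Z.
  rewrite /Z /avg mulmx_sumr; apply: eq_bigr => x _; rewrite !mulmxA -er.
  by rewrite -(mulmxA (r1 x) e e) ee.
have Ze' : Z *m e' = Z.
  rewrite /Z /avg mulmx_suml; apply: eq_bigr => x _.
  by rewrite -!mulmxA e'r (mulmxA e') e'e'.
exists (X + Z); first by move=> x; rewrite mulmxDr mulmxDl Xi Zi.
(* [e'] fixes the rows of Z and kills those of X, so the row spaces are disjoint and the ranks add
   up. *)
have disj : (X :&: Z = 0)%MS.
  apply/eqP; rewrite -submx0; apply/row_subP => i.
  have : (row i (X :&: Z)%MS <= X :&: Z)%MS by apply: row_sub.
  rewrite sub_capmx => /andP[/submxP [p pE] /submxP [q qE]].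
  by rewrite submx0 qE -Ze' mulmxA -qE pE -mulmxA Xe' mulmx0.
have ZX : (Z <= (X + Z)%R)%MS.
  by apply/submxP; exists e; rewrite mulmxDr eX add0r eZ.
have sub : (X + Z <= (X + Z)%R)%MS.
  rewrite addsmx_sub ZX andbT.
  by rewrite -{1}[X](addrK Z) addmx_sub // -scaleN1r scalemx_sub.
apply: leq_trans (mxrankS sub); rewrite (mxrank_disjoint_sum disj).
by rewrite -addn1 leq_add2l lt0n mxrank_eq0.
Qed.

(** Start from the intertwiner 0 and raise the rank, which is at most m, until X is invertible. *)
Lemma char_intertwiner : exists2 X, intertwiner X & row_free X && row_full X.
Proof.
have step k : forall X, intertwiner X -> (m - \rank X < k)%N ->
    exists2 X, intertwiner X & row_free X && row_full X.
  elim: k => // k IH X Xi Xk; have [Xb|Xn] := boolP (row_free X && row_full X).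
    by exists X.
  have [X' X'i X'r] := mxrank_intertwiner_lt Xi Xn; apply: (IH X') => //.
  by have := rank_leq_row X'; lia.
apply: (step (m - \rank (0 : 'M[F]_(m, n))).+1 0) => //.
by move=> x; rewrite mulmx0 mul0mx.
Qed.

End RepSim.

(** * Equivalence and eigenvalues *)


(** By linearity the sums of p(x) agree for every polynomial p; one vanishing at all other listed
    values isolates the multiplicity of x. *)
Lemma psums_perm_eq (K : numFieldType) (s1 s2 : seq K) :
  (forall n, \sum_(x <- s1) x ^+ n = \sum_(x <- s2) x ^+ n) -> perm_eq s1 s2.
Proof.
move=> E; have Ep (p : {poly K}) : \sum_(x <- s1) p.[x] = \sum_(x <- s2) p.[x].
  under eq_bigr => x _ do rewrite horner_coef.
  under [RHS]eq_bigr => x _ do rewrite horner_coef.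
  rewrite exchange_big [RHS]exchange_big; apply: eq_bigr => i _ /=.
  by rewrite -!mulr_sumr E.
apply/allP => x _ /=; apply/eqP.
pose p := \prod_(y <- rem x (undup (x :: s1 ++ s2))) ('X - y%:P).
have px : p.[x] != 0.
  rewrite -[_ == 0]/(root p x) root_prod_XsubC mem_rem_uniq ?undup_uniq //.
  by rewrite !inE eqxx.
have pE s : {subset s <= s1 ++ s2} -> \sum_(y <- s) p.[y] = (count_mem x s)%:R * p.[x].
  elim: s => [|y s IH] ss; first by rewrite big_nil mul0r.
  rewrite big_cons IH => [|z zs]; last by apply: ss; rewrite inE zs orbT.
  rewrite /= natrD mulrDl; congr (_ + _); case: eqP => [->|/eqP yx].
    by rewrite mul1r.
  rewrite mul0r; apply/eqP; rewrite -[_ == 0]/(root p y) root_prod_XsubC.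
  rewrite mem_rem_uniq ?undup_uniq // !inE yx mem_undup inE ss ?orbT //.
  exact: mem_head.
have := Ep p; rewrite !pE => [|y|y]; rewrite ?mem_cat; try by move=> ->; rewrite ?orbT.
by move/(mulIf px)/eqP; rewrite eqr_nat => /eqP.
Qed.

Section Eigs.
Variable K : numClosedFieldType.
Implicit Types R S : Rmatrix K.

Definition eigenframe (V : vectType K) (A : 'End(tensor V V)) d
    (u : 'I_d -> V) (u' : 'I_d -> 'Hom(V, K^o)) (t : 'I_d -> K) :=
  [/\ is_frame u u', forall i j, u' i (u j) = (i == j)%:R
    & forall i, ptr A (u i) = t i *: u i].

Lemma Rop_AT R : (Rop R \o tensor_map (ptr (Rop R)) \1 =
  tensor_map \1 (ptr (Rop R)) \o Rop R)%VF.
Proof.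
by apply: ptr_intertwines; [exact: Rop_unitary | exact: Rop_invol | exact: Rop_YB].
Qed.

Lemma eigenframe_exists R :
  exists (u : 'I_(Rdim R) -> base R) u' t, eigenframe (Rop R) u u' t.
Proof.
have [e eP] := onb_exists (base R).
have sA := unitary_invol_selfadj (@Rop_unitary _ R) (Rop_invol R).
have [u [t [uP Tu]]] := selfadj_spectral eP (ptr_selfadj eP sA).
exists u, (odual u), t; split=> //; first exact: onb_frame.
exact: odual_onb.
Qed.

Lemma psum_cyc R d (u : 'I_d -> base R) u' t n : eigenframe (Rop R) u u' t ->
  \sum_i t i ^+ n = ltr (cyc (Rop R) n.+1 n).
Proof.
case=> uP uD Tu; have := ltr_cyc (Rop_AT R) uP uD Tu n (fun=> 1).
rewrite (fop1 t uP uD) tensor_map1 comp_lfun1r => ->.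
by apply: eq_bigr => i _; rewrite mul1r.
Qed.

Definition is_eigs R (s : seq K) :=
  exists (u : 'I_(Rdim R) -> base R) u' t,
    eigenframe (Rop R) u u' t /\ s = [seq t i | i <- enum 'I_(Rdim R)].

Lemma eigs_exists R : exists s, is_eigs R s.
Proof.
have [u [u' [t H]]] := eigenframe_exists R.
by exists [seq t i | i <- enum 'I_(Rdim R)], u, u', t.
Qed.

(** A chosen listing of the spectrum of T; by [eigs_perm] every eigenframe yields the same
    multiset. *)
Definition eigs R : seq K := sval (cid (eigs_exists R)).

Lemma eigsP R : is_eigs R (eigs R). Proof. exact: svalP. Qed.

Lemma size_eigs R : size (eigs R) = Rdim R.
Proof. by have [u [u' [t [_ ->]]]] := eigsP R; rewrite size_map size_enum_ord. Qed.

Lemma sum_map_enum d (t : 'I_d -> K) (f : K -> K) :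
  \sum_(x <- [seq t i | i <- enum 'I_d]) f x = \sum_i f (t i).
Proof. by rewrite big_map big_enum. Qed.

Lemma psum_eigs R n : \sum_(x <- eigs R) x ^+ n = ltr (cyc (Rop R) n.+1 n).
Proof.
by have [u [u' [t [H ->]]]] := eigsP R; rewrite sum_map_enum (psum_cyc n H).
Qed.

Lemma eigs_perm R d (u : 'I_d -> base R) u' t : eigenframe (Rop R) u u' t ->
  perm_eq (eigs R) [seq t i | i <- enum 'I_d].
Proof.
by move=> H; apply: psums_perm_eq => n; rewrite psum_eigs sum_map_enum (psum_cyc n H).
Qed.

Lemma eigs_rational R x : x \in eigs R ->
  exists a : nat, [/\ (0 < a)%N, (a %| count_mem x (eigs R))%N & x = a%:R \/ x = - a%:R].
Proof.
move=> xR; have x0 : (0 < count_mem x (eigs R))%N by rewrite -has_count has_pred1.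
apply: eigen_rational => // e e2 n.
have [u [u' [t [[uP uD Tu] tE]]]] := eigsP R.
have [m mE] := qsym_nat (Rop_invol R) (@Rop_YB _ R) (Rop_AT R) uP uD Tu x e2 n.
exists m; rewrite -mE (ltr_qsym (Rop_invol R) (@Rop_YB _ R) (Rop_AT R) uP uD Tu x e2).
apply: eq_bigr => k _; congr (_ + _).
rewrite -(sum_map_enum t (fun y => (y == x)%:R)) -tE.
by elim: (eigs R) => [|y s IH]; rewrite ?big_nil // big_cons /= natrD IH.
Qed.

Lemma srep_is_rho R n : is_rho (@srep _ _ (Rop R) n).
Proof.
have [AA YB] := (Rop_invol R, @Rop_YB _ R).
by split=> [|s t|i j ij]; [exact: srep1 | exact: srepM | exact: srep_tperm].
Qed.

Lemma is_rho_srep R n rho : @is_rho _ R n rho -> forall s, rho s = srep (Rop R) s.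
Proof.
by case=> r1 rM rT; apply: srep_unique; [exact: Rop_invol | exact: Rop_YB | | |].
Qed.

Lemma ltr_equiv (X Y : vectType K) (F : 'Hom(X, Y)) (f : 'End(X)) (g : 'End(Y)) :
  bijective F -> (F \o f = g \o F)%VF -> ltr f = ltr g.
Proof.
case=> G FK GK FfgF; have G_lin : linear G.
  by move=> c x y; apply: (can_inj FK); rewrite linearP /= !GK.
have FG : (F \o linfun G = \1)%VF.
  by apply/lfunP=> y; rewrite comp_lfunE linfunK // GK id_lfunE.
have GF : (linfun G \o F = \1)%VF.
  by apply/lfunP=> y; rewrite comp_lfunE linfunK // FK id_lfunE.
rewrite -[g]comp_lfun1r -FG comp_lfunA -FfgF ltrC comp_lfunA GF comp_lfun1l //.
Qed.

Lemma Requiv_perm R S : Requiv R S -> perm_eq (eigs R) (eigs S).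
Proof.
move=> RS; apply: psums_perm_eq => n; rewrite !psum_eigs.
have [rho [sig [rP sP [F [bF FE]]]]] := RS n.+1 isT.
(* This permutation is the cycle through all n+1 sites. *)
have cE Q : cyc (Rop Q) n.+1 n = srep (Rop Q) (lift_perm ord0 ord_max (1%g : 'S_n)).
  by rewrite srep_lift srep1 tensor_map1 comp_lfun1r.
by rewrite !cE -(is_rho_srep rP) -(is_rho_srep sP); exact: ltr_equiv bF (FE _).
Qed.

Lemma perm_Requiv R S : perm_eq (eigs R) (eigs S) -> Requiv R S.
Proof.
move=> RS n _; exists (@srep _ _ (Rop R) n), (@srep _ _ (Rop S) n).
split; try exact: srep_is_rho.
have [u [u' [t [[uP uD Tu] tE]]]] := eigsP R.
have [w [w' [r [[wP wD Tw] rE]]]] := eigsP S.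
have tr (f : K -> K) : \sum_i f (t i) = \sum_i f (r i).
  by rewrite -!sum_map_enum -tE -rE; exact: perm_big.
have chi := ltr_srep_eq (Rop_invol R) (@Rop_YB _ R) (Rop_invol S) (@Rop_YB _ S)
  (Rop_AT R) (Rop_AT S) uP uD wP wD Tu Tw tr.
(* [f2mx] reverses composition and so does [srep], whence the matrices multiply in the order of
   S_n. *)
have [||||| X Xi /andP[free full]] := @char_intertwiner K 'S_n _ _
  (fun s => f2mx (srep (Rop R) s)) (fun s => f2mx (srep (Rop S) s)).
- by rewrite srep1 f2mx1.
- by rewrite srep1 f2mx1.
- by move=> x y; rewrite srepM ?f2mx_comp //; [exact: Rop_invol | exact: Rop_YB].
- by move=> x y; rewrite srepM ?f2mx_comp //; [exact: Rop_invol | exact: Rop_YB].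
- exact: chi.
have XV : X *m pinvmx X = 1%:M by exact: mulmxVp.
have VX : pinvmx X *m X = 1%:M by exact: mulVpmx.
exists (Hom X); split; last by move=> s; apply: f2mx_inj; rewrite !f2mx_comp; exact: Xi.
exists (Hom (pinvmx X) : 'Hom(_, _)) => v; rewrite -comp_lfunE.
  suff -> : (Hom (pinvmx X) \o Hom X = \1)%VF by rewrite id_lfunE.
  by apply: f2mx_inj; rewrite f2mx_comp f2mx1.
suff -> : (Hom X \o Hom (pinvmx X) = \1)%VF by rewrite id_lfunE.
by apply: f2mx_inj; rewrite f2mx_comp f2mx1.
Qed.

End Eigs.

(** * Young diagrams *)


Section Young.
Local Open Scope nat_scope.

(** A row of length a stands for a copies of the eigenvalue a, so the length of the list counts
    boxes. *)
Definition spread (s : seq nat) : seq nat := flatten [seq nseq a a | a <- s].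

Lemma count_spread a s : count_mem a (spread s) = a * count_mem a s.
Proof.
elim: s => [|b s IH]; first by rewrite muln0.
rewrite /spread /= count_cat -/(spread s) IH count_nseq /=.
by case: eqP => [->|_]; rewrite ?mul1n ?mul0n ?mulnDr ?muln1.
Qed.

Lemma size_spread s : size (spread s) = sumn s.
Proof. by elim: s => //= a s IH; rewrite size_cat size_nseq -IH. Qed.

Lemma young_eq (y z : young) :
  (forall a, 0 < a -> count_mem a (val y) = count_mem a (val z)) -> y = z.
Proof.
case: y z => [s /= sP] [r /= rP] E; apply: val_inj => /=.
have [/andP[ss s0] /andP[sr r0]] := (sP, rP).
have geq_anti : antisymmetric geq by move=> m n /andP[mn nm]; apply/anti_leq/andP.
have geq_tr : transitive geq by move=> m n p /= mn pm; apply: leq_trans pm mn.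
apply: (sorted_eq geq_tr geq_anti ss sr); apply/allP => a _ /=; apply/eqP.
case: a => [|a]; last exact: E.
by rewrite (count_memPn s0) (count_memPn r0).
Qed.

(* [c a] is to be a times the number of rows of length [a]. *)
Definition rows_of (c : nat -> nat) (n : nat) : seq nat :=
  sort geq (flatten [seq nseq (c a %/ a) a | a <- iota 1 n]).

Lemma rows_of_young c n : sorted geq (rows_of c n) && (0 \notin rows_of c n).
Proof.
apply/andP; split; first by apply: sort_sorted => m p; exact: leq_total.
rewrite mem_sort; apply/flattenP => -[r /mapP[a]].
by rewrite mem_iota => /andP[a0 _] -> /nseqP[a00]; rewrite -a00 in a0.
Qed.

Definition young_of c n : young :=
  exist (fun s : seq nat => sorted geq s && (0 \notin s)) _ (rows_of_young c n).

Lemma count_rows_of c n a : 0 < a <= n -> count_mem a (rows_of c n) = c a %/ a.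
Proof.
move=> /andP[a0 an]; rewrite /rows_of (seq.permP (permEl (perm_sort _ _))) count_flatten.
rewrite -map_comp sumnE big_map (bigD1_seq a) ?iota_uniq //=;
  last by rewrite mem_iota a0 add1n ltnS.
rewrite count_nseq /= eqxx mul1n big1 ?addn0 // => b ba.
by rewrite count_nseq /= (negPf ba) mul0n.
Qed.

End Young.

Section PairEigs.
Variable K : numFieldType.

Definition pair_eigs (p : young * young) : seq K :=
  [seq a%:R | a <- spread (val p.1)] ++ [seq - a%:R | a <- spread (val p.2)].

Lemma size_pair_eigs p : size (pair_eigs p) = (boxes p.1 + boxes p.2)%N.
Proof. by rewrite size_cat !size_map !size_spread. Qed.

Lemma count_pair_eigsl p (a : nat) : (0 < a)%N ->
  count_mem (a%:R : K) (pair_eigs p) = (a * count_mem a (val p.1))%N.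
Proof.
move=> a0; rewrite count_cat !count_map -count_spread.
rewrite [X in (_ + X)%N](_ : _ = 0%N) ?addn0; last first.
  apply/eqP; rewrite -leqn0 leqNgt -has_count; apply/hasPn => b _ /=.
  by apply/eqP => ba; have := ler0n K b; rewrite -oppr_le0 ba lern0; case: a a0 {ba}.
by apply: eq_count => b /=; rewrite eqr_nat.
Qed.

Lemma count_pair_eigsr p (a : nat) : (0 < a)%N ->
  count_mem (- a%:R : K) (pair_eigs p) = (a * count_mem a (val p.2))%N.
Proof.
move=> a0; rewrite count_cat !count_map -count_spread.
rewrite [X in (X + _)%N](_ : _ = 0%N) ?add0n; last first.
  apply/eqP; rewrite -leqn0 leqNgt -has_count; apply/hasPn => b _ /=.
  by apply/eqP => ba; have := ler0n K b; rewrite ba oppr_ge0 lern0; case: a a0 {ba}.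
by apply: eq_count => b /=; rewrite eqr_opp eqr_nat.
Qed.

Lemma pair_eigs_inj p q : perm_eq (pair_eigs p) (pair_eigs q) -> p = q.
Proof.
move=> /seq.permP E; case: p q E => [p1 p2] [q1 q2] E.
congr (_, _); apply: young_eq => a a0; apply/eqP; rewrite -(eqn_pmul2l a0).
  by rewrite -(count_pair_eigsl (p1, p2)) // -(count_pair_eigsl (q1, q2)) // E.
by rewrite -(count_pair_eigsr (p1, p2)) // -(count_pair_eigsr (q1, q2)) // E.
Qed.

Lemma pair_eigs_surj (s : seq K) :
  (forall x, x \in s -> exists a : nat,
     [/\ (0 < a)%N, (a %| count_mem x s)%N & x = a%:R \/ x = - a%:R]) ->
  exists p, perm_eq s (pair_eigs p).
Proof.
move=> sP; pose cp a := count_mem (a%:R : K) s; pose cn a := count_mem (- a%:R : K) s.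
pose y1 : young := young_of cp (size s).
pose y2 : young := young_of cn (size s).
have pn a b : (0 < a)%N -> a%:R = - b%:R :> K -> False.
  by rewrite -(ltr0n K) => a0 ab; move: a0; rewrite ab oppr_gt0 ltrn0.
have dp a : (0 < a)%N -> (a %| cp a)%N.
  move=> a0; have [as_|ns] := boolP (a%:R \in s); last first.
    by rewrite /cp (count_memPn ns) dvdn0.
  have [b [b0 bd [/eqP|]]] := sP _ as_; last by move/(pn _ _ a0).
  by rewrite eqr_nat => /eqP abE; rewrite -abE in bd.
have dn a : (0 < a)%N -> (a %| cn a)%N.
  move=> a0; have [as_|ns] := boolP (- a%:R \in s); last first.
    by rewrite /cn (count_memPn ns) dvdn0.
  have [b [b0 bd [/esym/(pn _ _ b0)//|]]] := sP _ as_.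
  by move/eqP; rewrite eqr_opp eqr_nat => /eqP abE; rewrite -abE in bd.
have rows c a : (0 < a)%N -> (c a <= size s)%N -> (a %| c a)%N ->
    (a * count_mem a (rows_of c (size s)) = c a)%N.
  move=> a0 cs ac; have [an|an] := leqP a (size s).
    by rewrite count_rows_of ?a0 // mulnC divnK.
  (* A positive multiple of a is at least a, so no row is longer than [size s]. *)
  have c0 : c a = 0%N.
    apply/eqP; apply: contraLR an; rewrite -lt0n -leqNgt => c0.
    by rewrite (leq_trans _ cs) // dvdn_leq.
  rewrite c0 (count_memPn _) ?muln0 // mem_sort; apply/flattenP => -[r /mapP[b]].
  rewrite mem_iota => bs -> /nseqP[ab _]; move: bs an; rewrite -ab; lia.
exists (y1, y2); apply/allP => x; rewrite mem_cat => xs; apply/eqP => /=.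
suff [a [a0 [->|->]]] : exists a : nat, (0 < a)%N /\ (x = a%:R \/ x = - a%:R).
- by rewrite count_pair_eigsl //= rows ?dp ?count_size.
- by rewrite count_pair_eigsr //= rows ?dn ?count_size.
case/orP: xs => [/sP[a [a0 _ ax]]|]; first by exists a.
have sp y b : b \in spread (val (y : young)) -> (0 < b)%N.
  move/flattenP => [r /mapP[c cy ->] /nseqP[-> //]].
rewrite mem_cat => /orP[] /mapP[b /sp b0 ->]; exists b; split=> //; [by left | by right].
Qed.

End PairEigs.

(** * Normal forms *)


Section NormalForm.
Variables (K : numClosedFieldType) (d : nat) (b : 'I_d -> nat) (sg : nat -> bool).

Definition std_hilbert : hilbert K := @Hilbert K 'rV[K]_d (@dotmx K d).
Local Notation V := std_hilbert.

Definition ev (i : 'I_d) : V := delta_mx 0 i.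
Definition ev' (i : 'I_d) : 'Hom(V, K^o) := linfun (fun v : V => (v : 'rV[K]_d) 0 i : K^o).
Local Notation ee i j := (pure (ev i) (ev j)).

Lemma ev'E i (v : V) : ev' i v = (v : 'rV[K]_d) 0 i.
Proof. by rewrite linfunK // => c x y; rewrite !mxE. Qed.

Lemma ev_frame : is_frame ev ev'.
Proof.
move=> v; rewrite [RHS]row_sum_delta; apply: eq_bigr => i _.
by rewrite ev'E.
Qed.

Lemma ev_dual i j : ev' i (ev j) = (i == j)%:R.
Proof. by rewrite ev'E mxE eqxx. Qed.

Lemma ev_onb i j : inner V (ev i) (ev j) = (i == j)%:R.
Proof.
rewrite [LHS]dotmxE mxE (bigD1 j) //= big1 => [|k kj]; rewrite !mxE !eqxx /=.
  by rewrite conjC1 mulr1 addr0 eq_sym.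
by rewrite (negPf kj) conjC0 mulr0.
Qed.

Let s (i : 'I_d) : K := (-1) ^+ sg (b i).
(* Basis vectors i and j are in the same block when b i = b j. *)
Definition nfb i j : tensor V V := if b i == b j then s i *: ee i j else ee j i.

Definition nf : 'End(tensor V V) :=
  linfun (fun X : tensor V V => \sum_i \sum_j (ev' j (X (ev' i)) : K) *: nfb i j).

Lemma nfE i j : nf (ee i j) = nfb i j.
Proof.
rewrite linfunK => [|c X Y].
  rewrite (bigD1 i) //= [X in _ + X]big1 => [|k ki].
    rewrite addr0 (bigD1 j) //= big1 => [|k kj]; rewrite pureE linearZ /= !ev_dual !eqxx.
      by rewrite addr0 !scale1r.
    by rewrite (negPf kj) scaler0 scale0r.
  rewrite big1 // => l _; rewrite pureE ev_dual.
  by rewrite (negPf ki) scale0r linear0 scale0r.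
rewrite scaler_sumr -big_split; apply: eq_bigr => i' _ /=.
rewrite scaler_sumr -big_split; apply: eq_bigr => j' _ /=.
by rewrite lfun_combE linearP /= scalerDl scalerA.
Qed.

Lemma ee_expand (X : tensor V V) :
  X = \sum_i \sum_j (ev' j (X (ev' i)) : K) *: ee i j.
Proof.
rewrite -{1}[X](tensor_frame _ ev_frame); apply: eq_bigr => i _.
rewrite -{1}[X (ev' i)]ev_frame -innE linear_sum; apply: eq_bigr => j _ /=.
by rewrite innE pureZr.
Qed.

Lemma ee_ext (U : vectType K) (f g : 'Hom(tensor V V, U)) :
  (forall i j, f (ee i j) = g (ee i j)) -> f = g.
Proof.
move=> fg; apply/lfunP => X; rewrite [X]ee_expand !linear_sum; apply: eq_bigr => i _ /=.
by rewrite !linear_sum; apply: eq_bigr => j _ /=; rewrite !linearZ /= fg.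
Qed.

Lemma eee_ext (U : vectType K) (f g : 'Hom(tensor (tensor V V) V, U)) :
  (forall i j k, f (pure (ee i j) (ev k)) = g (pure (ee i j) (ev k))) -> f = g.
Proof.
move=> fg; apply: tensor_ext => X v.
rewrite -[v]ev_frame -innE !linear_sum; apply: eq_bigr => k _ /=.
rewrite !linearZ /= innE; congr (_ *: _).
rewrite [X]ee_expand pure_suml !linear_sum; apply: eq_bigr => i _ /=.
rewrite pure_suml !linear_sum; apply: eq_bigr => j _ /=.
by rewrite pureZl !linearZ /= fg.
Qed.

Lemma s2 i : s i * s i = 1.
Proof. by rewrite /s -expr2 sqrr_sign. Qed.

Lemma s_eq i j : b i = b j -> s i = s j.
Proof. by rewrite /s => ->. Qed.

Lemma nf_invol : (nf \o nf = \1)%VF.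
Proof.
apply: ee_ext => i j; rewrite comp_lfunE id_lfunE nfE /nfb.
case: (eqVneq (b i) (b j)) => ij; rewrite ?linearZ /= nfE /nfb.
  by rewrite ij eqxx scalerA s2 scale1r.
by rewrite eq_sym (negPf ij).
Qed.

(** On a basis triple each factor either multiplies by the sign of a block or swaps neighbours, and
    which one depends only on the coincidences among the three blocks. *)
Lemma nf_YB : yang_baxter nf.
Proof.
have A12 i j k : tensor_map nf \1%VF (pure (ee i j) (ev k)) =
    if b i == b j then s i *: pure (ee i j) (ev k) else pure (ee j i) (ev k).
  by rewrite tensor_map_pure nfE id_lfunE /nfb; case: eqP => _ //; rewrite pureZl.
pose a := tensor_assoc V V V.
have A23 i j k : (a^-1 \o tensor_map \1 nf \o a)%VF (pure (ee i j) (ev k)) =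
    if b j == b k then s j *: pure (ee i j) (ev k) else pure (ee i k) (ev j).
  rewrite !comp_lfunE tensor_assoc_pure tensor_map_pure nfE id_lfunE /nfb.
  by case: eqP => _; rewrite ?pureZr ?linearZ /= tensor_assocV_pure.
rewrite /yang_baxter /=; apply: eee_ext => i j k.
move: A23; move: (a^-1 \o tensor_map \1 nf \o a)%VF => B A23.
rewrite !(comp_lfunE (_ \o _)%VF) !(comp_lfunE _ (tensor_map _ _)) !(comp_lfunE _ B).
rewrite A12 A23.
case: (eqVneq (b i) (b j)) => ij; case: (eqVneq (b j) (b k)) => jk;
case: (eqVneq (b i) (b k)) => ik; 
  do 3 rewrite ?linearZ /= ?(A12, A23) ?ij ?jk ?ik ?eqxx ?(negPf ij) ?(negPf jk) ?(negPf ik);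
  rewrite //=.
- by rewrite (s_eq ij).
- by rewrite ij jk eqxx in ik.
- by rewrite ik jk eqxx in ij.
by rewrite [b k == b j]eq_sym (negPf jk).
Qed.

(** Up to signs, [nf] permutes the orthonormal basis e_i (x) e_j. A pair within one block is never
    sent to a pair from two blocks, which is what [mix] expresses. *)
Lemma nf_unitary : unitary nf.
Proof.
have tZ (x y : K) (S T : tensor V V) :
    tensor_inner (x *: S) (y *: T) = x * (y^* * tensor_inner S T).
  rewrite /tensor_inner mulr_sumr mulr_sumr; apply: eq_bigr => i _.
  rewrite !mulr_sumr; apply: eq_bigr => j _; rewrite !scale_lfunE.
  rewrite linearZl_LR linearZr_LR /=; ring.
have mix i j k l : b i = b j -> b k != b l -> (i == k)%:R * (j == l)%:R = 0 :> K.
  move=> ij kl; case: (eqVneq i k) => [ik|_]; last by rewrite mul0r.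
  case: (eqVneq j l) => [jl|_]; last by rewrite mulr0.
  by rewrite -ik -jl ij eqxx in kl.
have key i j k l : tensor_inner (nf (ee i j)) (nf (ee k l)) = tensor_inner (ee i j) (ee k l).
  have sC m : (s m)^* = s m by rewrite /s rmorph_sign.
  rewrite !nfE /nfb tensor_inner_pure !ev_onb.
  case: (eqVneq (b i) (b j)) => ij; case: (eqVneq (b k) (b l)) => kl.
  - rewrite tZ tensor_inner_pure !ev_onb sC; have [->|_] := eqVneq i k.
      by rewrite mulrA s2 mul1r.
    by rewrite !mul0r !mulr0.
  - rewrite -[ee l k]scale1r tZ tensor_inner_pure !ev_onb !mix ?mulr0 //.
    by rewrite eq_sym.
  - rewrite -[ee j i]scale1r tZ tensor_inner_pure !ev_onb.
    rewrite (eq_sym j) (eq_sym i) (eq_sym i) (eq_sym j) !mix ?mulr0 // eq_sym //.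
  by rewrite tensor_inner_pure !ev_onb mulrC.
move=> S T; rewrite [S]ee_expand [T]ee_expand !linear_sum.
rewrite !tensor_inner_suml; apply: eq_bigr => i _ /=.
rewrite !linear_sum !tensor_inner_suml; apply: eq_bigr => j _ /=.
rewrite !tensor_inner_sumr; apply: eq_bigr => k _ /=.
rewrite !linear_sum !tensor_inner_sumr; apply: eq_bigr => l _ /=.
by rewrite !linearZ /= !tZ key.
Qed.

(** Each i in the block of j contributes the sign of the block; for other i the flip puts e_j into
    the traced factor, where the dual vector of e_i kills it. *)
Lemma nf_eigenframe :
  eigenframe nf ev ev' (fun j => s j * (#|[pred i | b i == b j]|)%:R).
Proof.
split; [exact: ev_frame | exact: ev_dual | move=> j].
rewrite (ptr_frameE _ _ ev_frame) -sum1_card natr_sum mulr_sumr scaler_suml.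
rewrite [RHS]big_mkcond; apply: eq_bigr => i _; rewrite nfE /nfb inE.
case: eqVneq => ij; first by rewrite scale_lfunE pureE ev_dual eqxx scale1r mulr1 (s_eq ij).
rewrite pureE ev_dual; case: eqVneq => [ij'|_]; last by rewrite scale0r.
by rewrite ij' eqxx in ij.
Qed.

Lemma std_dim : \dim {:V} = d.
Proof. by rewrite dimvf /dim /= mul1n. Qed.

Hypothesis d_gt0 : (0 < d)%N.

Fact std_gt0 : (0 < \dim {:V})%N. Proof. by rewrite std_dim. Qed.

Definition nfR : Rmatrix K := RMatrix std_gt0 nf_unitary nf_invol nf_YB.

End NormalForm.

Section NormalFormPair.
Variable K : numClosedFieldType.

Definition block_list (s : seq nat) : seq nat :=
  flatten [seq nseq (nth 0%N s k) k | k <- iota 0 (size s)].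

Lemma map_nth_iota0 (s : seq nat) : [seq nth 0%N s k | k <- iota 0 (size s)] = s.
Proof. exact: mkseq_nth. Qed.

Lemma size_block_list s : size (block_list s) = sumn s.
Proof.
rewrite size_flatten /shape -map_comp -{3}(map_nth_iota0 s); congr sumn.
by apply: eq_map => k /=; rewrite size_nseq.
Qed.

Lemma count_block_list s k : (k < size s)%N -> count_mem k (block_list s) = nth 0%N s k.
Proof.
move=> ks; rewrite /block_list count_flatten -map_comp sumnE big_map.
rewrite (bigD1_seq k) ?iota_uniq //= ?mem_iota //.
rewrite count_nseq /= eqxx mul1n big1 ?addn0 // => j jk.
by rewrite count_nseq /= (negPf jk) mul0n.
Qed.

Lemma sumn_eq0_young (y : young) : sumn (val y) = 0%N -> y = young0.
Proof.
case: y => [[|a l] yP] /= l0; first exact: val_inj.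
by exfalso; have /andP[_] := yP; rewrite inE negb_or; case: (a) l0.
Qed.

Lemma pair_realized (p : young * young) : p != (young0, young0) ->
  exists R : Rmatrix K, perm_eq (eigs R) (pair_eigs K p).
Proof.
(* One block per row, those of the first diagram first: the blocks numbered from m on belong to the
   second and get the sign -1. *)
move=> p0; pose s := val p.1 ++ val p.2; pose m := size (val p.1).
pose bl := block_list s; pose sg k := (m <= k)%N.
pose b (i : 'I_(size bl)) := nth 0%N bl i.
have bl_gt0 : (0 < size bl)%N.
  rewrite size_block_list lt0n; apply: contra p0; rewrite sumn_cat addn_eq0.
  move=> /andP[/eqP/sumn_eq0_young p1 /eqP/sumn_eq0_young p2].
  by case: (p) p1 p2 => [q1 q2] /= -> ->.
exists (nfR K b sg bl_gt0).
apply: perm_trans (eigs_perm (R := nfR K b sg bl_gt0) (nf_eigenframe K b sg)) _.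
have blE : [seq b i | i <- enum 'I_(size bl)] = bl.
  by rewrite -[RHS](map_nth_iota0 bl) -val_enum_ord -map_comp.
have cardE k : #|[pred i | b i == k]| = count_mem k bl.
  by rewrite -[in RHS]blE count_map -sum1_card -sum1_count big_enum_cond.
pose F k : K := (-1) ^+ sg k * (nth 0%N s k)%:R.
rewrite (_ : map _ _ = [seq F k | k <- bl]); last first.
  rewrite -[in RHS]blE -map_comp; apply: eq_map => i /=; rewrite cardE /F.
  rewrite count_block_list //.
  have /flattenP[r /mapP[k]] : b i \in bl by rewrite mem_nth.
  by rewrite mem_iota => /andP[_ ks] -> /nseqP[-> _].
rewrite (_ : map F bl = pair_eigs K p) //.
have spE (f : nat -> K) l : [seq f a | a <- spread l] = flatten [seq nseq a (f a) | a <- l].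
  by rewrite map_flatten -map_comp; congr flatten; apply: eq_map => a /=; rewrite map_nseq.
rewrite /pair_eigs !spE /bl /block_list map_flatten -map_comp size_cat iotaD map_cat flatten_cat.
congr (flatten _ ++ flatten _).
  rewrite -[in RHS](map_nth_iota0 (val p.1)) -map_comp; apply/eq_in_map => k.
  rewrite mem_iota => /andP[_ km] /=; rewrite map_nseq /F /sg nth_cat -/m km.
  by rewrite leqNgt km mul1r.
rewrite add0n -[X in iota X _]addn0 iotaDl -map_comp.
rewrite -[in RHS](map_nth_iota0 (val p.2)) -map_comp; apply: eq_map => k /=.
rewrite map_nseq /F /sg nth_cat -/m ltnNge leq_addr /= addKn.
by rewrite expr1 mulN1r.
Qed.
End NormalFormPair.

(** * Equivalence classes *)


Section Classes.
Variable K : numClosedFieldType.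
Implicit Types (C : Rclass K) (p : young_pair).

Lemma Requiv_eq (R S : Rmatrix K) : perm_eq (eigs R) (eigs S) -> Requiv R = Requiv S.
Proof.
move=> RS; apply/funext => Q; apply/propext; split=> /Requiv_perm h; apply: perm_Requiv.
  by rewrite perm_sym in RS; apply: perm_trans RS h.
exact: perm_trans RS h.
Qed.

Lemma Rclass_eq C C' : Rclass_mem C = Rclass_mem C' -> C = C'.
Proof.
case: C C' => [c cP] [c' cP'] /= cc'; case: c' / cc' cP' => cP'.
by rewrite (Prop_irrelevance cP cP').
Qed.

Lemma Rclass_memE C (R : Rmatrix K) : C R -> Rclass_mem C = Requiv R.
Proof.
by case: C => c [S cE] /=; rewrite cE => /Requiv_perm/Requiv_eq.
Qed.

Lemma Rclass_inhabited C : exists R, C R.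
Proof. by have [R CE] := RclassP C; exists R; rewrite CE; apply: perm_Requiv. Qed.

(** Describing the class by its spectrum avoids choosing a representative; realizability shows that
    it is indeed a class. *)
Lemma pair_class p : exists R : Rmatrix K,
  (fun S : Rmatrix K => perm_eq (eigs S) (pair_eigs K (val p)) : Prop) = Requiv R.
Proof.
have [R Rp] := pair_realized K (valP p); exists R.
apply/funext => S; apply/propext; split=> [Sp|/Requiv_perm RS].
  by apply: perm_Requiv; apply: perm_trans Rp _; rewrite perm_sym.
by apply: perm_trans Rp; rewrite perm_sym.
Qed.

Definition class_of_pair p : Rclass K := RClass (pair_class p).

Lemma class_has_pair C : exists p, class_of_pair p = C.
Proof.
have [R CR] := Rclass_inhabited C.
have [q Rq] := pair_eigs_surj (@eigs_rational _ R).
(* The empty pair would leave no eigenvalues, against the base space being nonzero. *)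
have q0 : q != (young0, young0).
  apply: contraTneq (base_gt0 R) => q0; rewrite -[X in (_ < X)%N]/(Rdim R) -size_eigs.
  by rewrite (perm_size Rq) size_pair_eigs q0.
exists (exist _ q q0); apply: Rclass_eq.
rewrite (Rclass_memE CR); apply: Rclass_memE; exact: Rq.
Qed.

Definition pair_of_class C : young_pair := sval (cid (class_has_pair C)).

Lemma pair_of_classK : cancel pair_of_class class_of_pair.
Proof. by move=> C; exact: svalP (cid (class_has_pair C)). Qed.

Lemma class_of_pairK : cancel class_of_pair pair_of_class.
Proof.
move=> p; have := pair_of_classK (class_of_pair p); set q := pair_of_class _.
move/(congr1 (@Rclass_mem K)) => qp.
have [R Rp] := pair_realized K (valP p).
have Rq : class_of_pair q R by rewrite [Rclass_mem _]qp.
apply: val_inj; apply: (@pair_eigs_inj K).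
by apply: perm_trans Rp; rewrite perm_sym.
Qed.

Lemma Rclass_has_dim_boxes C d : Rclass_has_dim C d <-> pair_boxes (pair_of_class C) = d.
Proof.
rewrite -{1}[C]pair_of_classK; move: (pair_of_class C) => p.
have dimE (R : Rmatrix K) : class_of_pair p R -> Rdim R = pair_boxes p.
  by move=> /= Rp; rewrite -size_eigs (perm_size Rp) size_pair_eigs.
split=> [[R /dimE -> //] | <-].
by have [R Rp] := Rclass_inhabited (class_of_pair p); exists R; rewrite ?dimE.
Qed.

End Classes.

Theorem theorem1 (R : realType) :
  exists f : Rclass R[i] -> young_pair,
    bijective f /\
    forall d : nat, (0 < d)%N ->
      forall C : Rclass R[i], Rclass_has_dim C d <-> pair_boxes (f C) = d.
Proof.
exists (@pair_of_class _); split=> [|d _ C]; last exact: Rclass_has_dim_boxes.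
by exists (@class_of_pair _); [exact: pair_of_classK | exact: class_of_pairK].
Qed.
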